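(* Let $\alpha\in(0,1)$, let $J=[0,T]$ for some $T>0$ or $J=[0,\infty)$, and let $f:J\times\mathbb{R}\to\mathbb{R}$ be continuous and satisfy $|f(t,x)-f(t,y)|\le L(t)|x-y|$ for all $t\in J$, $x,y\in\mathbb{R}$, where $L:J\to[0,\infty)$ is continuous. Consider ${}^{C}D^\alpha_{0+}x(t)=f(t,x(t))$ on $J$ and its evolution mappings $\Phi_{0,t}:\mathbb{R}\to\mathbb{R}$, $t\in J$. Then: (i) $\Phi_{0,t}$ is a bijection for every $t\in J$; (ii) the maps $\Phi_{s,t}:=\Phi_{0,t}\circ\Phi_{0,s}^{-1}$, $s,t\in J$, form a two-parameter family of bijections of $\mathbb{R}$ satisfying $\Phi_{s,t}\circ\Phi_{u,s}=\Phi_{u,t}$ for all $u,s,t\in J$; (iii) the family $(\Phi_{s,t})_{s,t\in J}$ is a two-parameter flow in $\mathbb{R}$; (iv) if $f$ is linear in $x$ (i.e. $f(t,x)=a(t)x$), then each $\Phi_{s,t}$ is a linear map of $\mathbb{R}$.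
   Context: ${}^{C}D^\alpha_{0+}$ is the Caputo fractional derivative of order $\alpha$; a solution is a continuous $x:J\to\mathbb{R}$ with $x(t)=x(0)+\frac{1}{\Gamma(\alpha)}\int_0^t(t-\tau)^{\alpha-1}f(\tau,x(\tau))\,d\tau$ for all $t\in J$; under the Lipschitz condition each initial value $x_0$ yields a unique solution on $J$. The evolution mapping $\Phi_{0,t}$ sends $x_0\in\mathbb{R}$ to $x(t)$, where $x(\cdot)$ is the solution with $x(0)=x_0$. A two-parameter flow in $\mathbb{R}$ is a family of maps $\phi_{s,t}:\mathbb{R}\to\mathbb{R}$, $s,t\in J$, such that $(s,t,x)\mapsto\phi_{s,t}(x)$ is continuous on $J\times J\times\mathbb{R}$, each $\phi_{s,t}$ is a homeomorphism of $\mathbb{R}$, and $\phi_{s,t}\circ\phi_{u,s}=\phi_{u,t}$ for all $u,s,t\in J$. *)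

(* Defs.v *)
From HB Require Import structures.
From mathcomp Require Import all_boot all_order all_algebra.
From mathcomp Require Import all_classical all_reals all_analysis.
Set Implicit Arguments. Unset Strict Implicit. Unset Printing Implicit Defensive.
Import Order.TTheory GRing.Theory Num.Theory.
Import numFieldNormedType.Exports.
Local Open Scope classical_set_scope.
Local Open Scope ring_scope.

Section FracDefs.
Variable R : realType.

Definition Gamma (a : R) : R :=
  \int[(@lebesgue_measure R)]_(x in `]0%R, +oo[) (x `^ (a - 1) * expR (- x)).

(* The time interval J = [0,T] (T finite, T > 0) or [0,oo) (T = +oo). *)
Definition Jint (T : \bar R) : set R := [set t | 0 <= t /\ (t%:E <= T)%E].

(* x is a solution on J of  ^C D^alpha_{0+} x = f(t, x(t)):
   x continuous on J and satisfying the Volterra integral equation. *)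
Definition is_frac_solution (alpha : R) (f : R -> R -> R) (J : set R)
    (x : R -> R) : Prop :=
  {within J, continuous x} /\
  forall t, J t ->
    x t = x 0 + (Gamma alpha)^-1 *
      \int[(@lebesgue_measure R)]_(tau in `[0%R, t])
         ((t - tau) `^ (alpha - 1) * f tau (x tau)).

(* The evolution mapping Phi_{0,t}: x0 |-> x(t), x the (unique) solution
   with x(0) = x0 (a chosen one, via classical choice). *)
Definition evol0 (alpha : R) (f : R -> R -> R) (J : set R) (t : R) (x0 : R) : R :=
  (get [set x : R -> R | is_frac_solution alpha f J x /\ x 0 = x0]) t.

Definition is_homeomorphism (g : R -> R) : Prop :=
  continuous g /\ exists h : R -> R,
    [/\ cancel g h, cancel h g & continuous h].

Definition two_param_flow (J : set R) (phi : R -> R -> R -> R) : Prop :=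
  [/\ {within [set p : (R * R) * R | J p.1.1 /\ J p.1.2],
        continuous (fun p : (R * R) * R => phi p.1.1 p.1.2 p.2)},
      (forall s t, J s -> J t -> is_homeomorphism (phi s t)) &
      (forall u s t, J u -> J s -> J t -> phi s t \o phi u s = phi u t)].

End FracDefs.

(* Main.v *)
Require Import Defs.
From HB Require Import structures.
From mathcomp Require Import all_boot all_order all_algebra.
From mathcomp Require Import all_classical all_reals all_analysis.
From mathcomp Require Import measurable_realfun ring lra.
Import Order.TTheory GRing.Theory Num.Theory.
Import numFieldNormedType.Exports.
Local Open Scope classical_set_scope.
Local Open Scope ring_scope.
Set Implicit Arguments.
Unset Strict Implicit.
Unset Printing Implicit Defensive.

(** The constant [1 / Gamma alpha] is absorbed into [f], and [f] is extended to all
    times by clamping time to [J]; then everything happens for a Volterra equation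
    [x t = x0 + I t], [I t] being the integral of [(t - s)^(alpha-1) g(s, x s)] over
    [[0, t]], with [g] continuous on the plane. Existence, uniqueness and Lipschitz
    dependence on [x0] come from Picard iteration and a Gronwall argument in a norm
    weighted by [exp(- lam t)].

    The point is that two solutions never meet. Their difference [w] satisfies
    [w t = w0 + ] the Abel integral of some [F] with [|F| <= M w] as long as [w >= 0].
    Let [A x s] be [w0] plus the integral of [(s - r)^(alpha-1) F r] over [[0, x]]: the
    value predicted at time [s] by the past up to [x]. For [x < t < s] the quotient of
    the kernels at [s] and [t] decreases in [x], and an integration by parts gives
    [A x s >= ((t - x) / (s - x))^(1-alpha) A x t], provided that [A] is nonnegative;
    and [A] is nonnegative because a negative infimum would be strictly improved by
    the same inequality. Since [w t] and [A x t] differ by [O((t - x)^alpha)] times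
    the recent values of [w], this bounds [w] at the end of an interval from below by
    [w] earlier, at any point around which [w] is at most doubled; such points are
    found by maximising [w t / (t1 - t + eta)]. The outcome, [w t1 >= c w0] with [c]
    independent of the solutions, gives injectivity and surjectivity of the evolution
    maps. Continuity of the inverses follows from monotonicity. *)

(** * The Abel kernel *)

Section AbelKernel.
Context {R : realType}.
Notation mu := (@lebesgue_measure R).
Implicit Types (p a b c s t x k H : R) (h : R -> R).

Lemma is_derive_subl_powR p s x : x < s ->
  is_derive x 1 (fun y => (s - y) `^ p) (- (p * (s - x) `^ (p - 1))).
Proof.
move=> xs.
have := @is_derive1_comp R (fun y => y `^ p) (fun y => s - y) x
  (p * (s - x) `^ (p - 1)) (-1).
rewrite mulrN1; apply.
  by apply: is_derive1_powR; rewrite subr_gt0.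
have h1 : is_derive x 1 (cst s : R -> R) 0 by exact: is_derive_cst.
have h2 : is_derive x 1 (fun y : R => y) 1 by exact: is_derive_id.
by have := is_deriveB h1 h2; rewrite sub0r.
Qed.

Lemma continuous_subl_powR p s x : x < s ->
  {for x, continuous (fun y => (s - y) `^ p)}.
Proof.
move=> xs; apply: differentiable_continuous; apply/derivable1_diffP.
by have [] := is_derive_subl_powR p xs.
Qed.

Lemma integral_subl_powR_lt p a b s : p != 0 -> a <= b -> b < s ->
  (\int[mu]_(x in `[a, b]) ((s - x) `^ (p - 1))%:E =
   (((s - a) `^ p - (s - b) `^ p) / p)%:E)%E.
Proof.
move=> p0; rewrite le_eqVlt => /predU1P[<- _|ab bs].
  by rewrite set_itv1 integral_set1 subrr mul0r.
pose F := fun y => - p^-1 * (s - y) `^ p.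
have dF x : x < s -> is_derive x 1 F ((s - x) `^ (p - 1)).
  move=> xs; have := is_derive_subl_powR p xs => h.
  rewrite /F; apply: is_derive_eq.
  by rewrite scalerN scaleNr opprK /GRing.scale/= mulrA mulVf// mul1r.
have cF x : x < s -> {for x, continuous F}.
  move=> xs; apply: differentiable_continuous; apply/derivable1_diffP.
  by have [] := dF _ xs.
rewrite (@continuous_FTC2 _ _ F a b ab).
- by rewrite -EFinB; congr EFin; rewrite /F; field.
- apply: continuous_in_subspaceT => x; rewrite inE/= in_itv/= => /andP[_ xb].
  by apply: continuous_subl_powR; exact: le_lt_trans bs.
- split.
  + move=> x; rewrite in_itv/= => /andP[_ xb].
    by have [] := dF x (lt_trans xb bs).
  + by apply: cvg_at_right_filter; apply: cF; exact: lt_trans bs.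
  + by apply: cvg_at_left_filter; apply: cF.
- move=> x; rewrite in_itv/= => /andP[_ xb].
  by rewrite derive1E; have [_ ->] := dF x (lt_trans xb bs).
Qed.

Lemma measurable_subl_powR p s (D : set R) : measurable D ->
  measurable_fun D (fun x => (s - x) `^ p).
Proof.
move=> mD; apply: measurable_funTS.
apply: (measurableT_comp (measurable_powR p)).
exact: measurable_funB.
Qed.

(** The absolute value matters: on negative bases [powR] is constantly 1, so the bare power is not
    continuous at 0 from the left. *)
Lemma powR_continuous0 p : 0 < p -> {for 0, continuous (fun x : R => `|x| `^ p)}.
Proof.
move=> p0; rewrite /prop_for /continuous_at normr0 powR0 ?gt_eqF//.
apply/cvgrPdist_lt => /= e e0; near=> x.
rewrite sub0r normrN ger0_norm ?powR_ge0//.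
have [->|x0] := eqVneq x 0; first by rewrite normr0 powR0 ?gt_eqF.
rewrite -[e](powRr1 (ltW e0)) -[1](@mulVf _ p) ?gt_eqF// powRrM.
apply: gt0_ltr_powR => //; rewrite ?nnegrE ?powR_ge0//.
near: x; apply: cvgr0_norm_lt; last exact: powR_gt0.
exact: cvg_id.
Unshelve. all: by end_near. Qed.

(** The kernel may blow up at [s], so [[a, s[] is exhausted by the segments [[a, b n]], where a
    primitive is available. Monotone convergence passes to the limit, and [(s - b n)^p] tends to 0
    because [0 < p]. *)
Lemma integral_subl_powR_co p a s : 0 < p -> a <= s ->
  (\int[mu]_(x in `[a, s[) ((s - x) `^ (p - 1))%:E =
   ((s - a) `^ p / p)%:E)%E.
Proof.
move=> p0; rewrite le_eqVlt => /predU1P[<-|as_].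
  by rewrite set_itv_ge ?bnd_simp ?ltxx// integral_set0 subrr powR0 ?gt_eqF// mul0r.
pose b n := s - (s - a) / n.+1%:R.
have bs n : b n < s by rewrite /b ltrBlDr ltrDl divr_gt0// subr_gt0.
have ab n : a <= b n.
  rewrite /b lerBrDr addrC -lerBrDr ler_pdivrMr// ler_peMr ?subr_ge0 ?(ltW as_)//.
  by rewrite ler1n.
have ->: `[a, s[%classic = \bigcup_n `[a, b n]%classic.
  apply/seteqP; split=> [x /=|x [n _] /=]; rewrite !in_itv/=; last first.
    by move=> /andP[-> /le_lt_trans]; apply; exact: bs.
  move=> /andP[ax xs].
  have sx : 0 < s - x by rewrite subr_gt0.
  have [n hn] : exists n, (s - a) / (s - x) < n.+1%:R.
    exists (Num.truncn ((s - a) / (s - x))).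
    exact: truncnS_gt.
  exists n => //=; rewrite in_itv/= ax/= /b lerBrDr addrC -lerBrDr.
  by rewrite ler_pdivrMr// -ler_pdivrMl// mulrC ltW.
have := @ge0_nondecreasing_set_cvg_integral _ (measurableTypeR R) R
  (fun n => `[a, b n]%classic) (fun x => ((s - x) `^ (p - 1))%:E) mu.
move=> /(_ _ _ _ _)/cvg_lim <- //.
- apply/cvg_lim => //.
  have -> : (fun i => \int[mu]_(x in `[a, b i]) ((s - x) `^ (p - 1))%:E)%E =
      (fun i => (((s - a) `^ p - (s - b i) `^ p) / p)%:E)%E.
    by apply/funext => n; rewrite integral_subl_powR_lt ?gt_eqF.
  apply: cvg_EFin; first exact: nearW.
  rewrite -[X in _ --> X / p]subr0.
  apply: cvgMl; apply: cvgB; first exact: cvg_cst.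
  have -> : (fun i => (s - b i) `^ p) =
      (fun x => `|x| `^ p) \o (fun i => (s - a) * (i.+1%:R)^-1).
    apply/funext => i /=; rewrite ger0_norm ?mulr_ge0 ?subr_ge0 ?(ltW as_)//.
    by rewrite /b opprB addrC subrK.
  have h := powR_continuous0 p0.
  rewrite /prop_for /continuous_at normr0 powR0 ?gt_eqF// in h.
  apply: cvg_comp h.
  have -> : nbhs (0 : R) = nbhs ((s - a) * 0) by rewrite mulr0.
  by apply: cvgMr; exact: cvg_harmonic.
- apply/nondecreasing_seqP => n; apply/subsetPset => x/=.
  rewrite !in_itv/= => /andP[-> xb]/=; rewrite (le_trans xb)//.
  rewrite /b lerB// ler_wpM2l ?subr_ge0 ?ltW// ltf_pV2 ?posrE// ltr_nat.
  by [].
- by move=> n; apply/measurable_EFinP; exact: measurable_subl_powR.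
- by move=> n x _; rewrite lee_fin powR_ge0.
Qed.

Lemma integrable_EFinB (D : set R) (f g : R -> R) : measurable D ->
  mu.-integrable D (EFin \o f) -> mu.-integrable D (EFin \o g) ->
  mu.-integrable D (EFin \o (fun x => f x - g x)).
Proof.
move=> mD fi gi; have := @integrableB _ (measurableTypeR R) R mu D mD _ _ fi gi.
by apply: eq_integrable => // x _ /=; rewrite EFinB.
Qed.

Lemma integrable_subl_powR p a b s : 0 < p -> b <= s ->
  mu.-integrable `[a, b] (fun x => ((s - x) `^ (p - 1))%:E).
Proof.
move=> p0 bs; have mk D : measurable D ->
    measurable_fun D (fun x => ((s - x) `^ (p - 1))%:E).
  by move=> mD; apply/measurable_EFinP; exact: measurable_subl_powR.
have [sa|as_] := ltP s a.
  by rewrite set_itv_ge ?bnd_simp -?ltNge ?(le_lt_trans bs)//; exact: integrable_set0.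
apply: (@integrableS _ _ _ mu `[a, s]%classic) => //.
  by apply: subset_itvl; rewrite bnd_simp.
apply/integrableP; split; first exact: mk.
under eq_integral do rewrite gee0_abs ?lee_fin ?powR_ge0//.
rewrite -integral_itv_bndo_bndc; last exact: mk.
by rewrite integral_subl_powR_co// ltry.
Qed.

Lemma integral_subl_powR p a b s : 0 < p -> a <= b -> b <= s ->
  \int[mu]_(x in `[a, b]) ((s - x) `^ (p - 1)) =
   ((s - a) `^ p - (s - b) `^ p) / p.
Proof.
move=> p0 ab; rewrite le_eqVlt => /predU1P[bs|bs]; last first.
  by rewrite /Rintegral integral_subl_powR_lt// gt_eqF.
rewrite bs in ab *; rewrite /Rintegral -integral_itv_bndo_bndc; last first.
  by apply/measurable_EFinP; exact: measurable_subl_powR.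
by rewrite integral_subl_powR_co//= subrr powR0 ?gt_eqF// subr0.
Qed.

(** For [a = 0] and [b = s] this is [Gamma p] times the Riemann-Liouville integral of order [p]. The
    upper limit [b] is kept apart from the time [s] of the kernel because the lower bound needs the
    effect at [s] of a past that ends earlier. *)
Definition abel p a b s (h : R -> R) : R :=
  \int[mu]_(x in `[a, b]) ((s - x) `^ (p - 1) * h x).

Lemma integrable_abel p a b s h : 0 < p -> b <= s -> continuous h ->
  mu.-integrable `[a, b] (EFin \o (fun x => (s - x) `^ (p - 1) * h x)).
Proof.
move=> p0 bs ch.
have := @integrableMl _ _ _ mu `[a, b] _ (fun x => ((s - x) `^ (p - 1))%:E) h.
move=> /(_ _ (integrable_subl_powR a p0 bs)) H.
have -> : EFin \o (fun x => (s - x) `^ (p - 1) * h x) =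
    ((fun x => ((s - x) `^ (p - 1))%:E) \* (EFin \o h))%E.
  by apply/funext => x /=; rewrite EFinM.
apply: H => //.
  by apply: measurable_funTS; exact: continuous_measurable_fun.
have /compact_bounded : compact (h @` `[a, b]).
  apply: continuous_compact; last exact: segment_compact.
  exact: continuous_subspaceT.
move=> [M [Mr HM]]; exists M; split => // y My x xab.
by apply: (HM y My); exists x.
Qed.

Lemma abel1 p a b s : 0 < p -> a <= b -> b <= s ->
  abel p a b s (cst 1) = ((s - a) `^ p - (s - b) `^ p) / p.
Proof.
move=> p0 ab bs; rewrite -integral_subl_powR//.
by apply: eq_Rintegral => x _; rewrite mulr1.
Qed.

Lemma abel_le p a b s h1 h2 : 0 < p -> b <= s ->
  continuous h1 -> continuous h2 ->
  (forall x, a <= x <= b -> h1 x <= h2 x) ->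
  abel p a b s h1 <= abel p a b s h2.
Proof.
move=> p0 bs c1 c2 h12; apply: le_Rintegral => //; try exact: integrable_abel.
by move=> x /=; rewrite in_itv/= => xab; rewrite ler_wpM2l ?powR_ge0 ?h12.
Qed.

Lemma abel_eq p a b s h1 h2 :
  (forall x, a <= x <= b -> h1 x = h2 x) -> abel p a b s h1 = abel p a b s h2.
Proof.
move=> h12; apply: eq_Rintegral => x; rewrite inE/= in_itv/= => xab.
by rewrite h12.
Qed.

Lemma abelB p a b s h1 h2 : 0 < p -> b <= s ->
  continuous h1 -> continuous h2 ->
  abel p a b s (fun x => h1 x - h2 x) = abel p a b s h1 - abel p a b s h2.
Proof.
move=> p0 bs c1 c2; rewrite /abel -RintegralB//; try exact: integrable_abel.
by apply: eq_Rintegral => x _; rewrite mulrBr.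
Qed.

Lemma abelD p a b s h1 h2 : 0 < p -> b <= s ->
  continuous h1 -> continuous h2 ->
  abel p a b s (fun x => h1 x + h2 x) = abel p a b s h1 + abel p a b s h2.
Proof.
move=> p0 bs c1 c2; rewrite /abel -RintegralD//; try exact: integrable_abel.
by apply: eq_Rintegral => x _; rewrite mulrDr.
Qed.

Lemma abelZ p a b s k h : 0 < p -> b <= s -> continuous h ->
  abel p a b s (fun x => k * h x) = k * abel p a b s h.
Proof.
move=> p0 bs c; rewrite /abel -RintegralZl//; try exact: integrable_abel.
by apply: eq_Rintegral => x _; rewrite mulrCA.
Qed.

Lemma abel_cat p a b c s h : 0 < p -> a <= b -> b <= c -> c <= s -> continuous h ->
  abel p a c s h = abel p a b s h + abel p b c s h.
Proof.
move=> p0 ab bc cs ch; apply/eqP; rewrite addrC -subr_eq; apply/eqP.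
have H := @Rintegral_itvB R (fun x => (s - x) `^ (p - 1) * h x) (BLeft a) (BRight c) b.
rewrite /abel H ?bnd_simp//; last exact: integrable_abel.
rewrite Rintegral_itv_obnd_cbnd//.
by apply: (@integrableS _ _ _ mu `[b, c]) => //;
  [exact: subset_itv_oc_cc|exact: integrable_abel].
Qed.

Lemma abel_norm_le p a b s h : 0 < p -> b <= s -> continuous h ->
  `|abel p a b s h| <= abel p a b s (fun x => `|h x|).
Proof.
move=> p0 bs ch; apply: (le_trans (le_normr_Rintegral _ _)) => //.
  exact: integrable_abel.
rewrite le_eqVlt; apply/orP; left; apply/eqP; apply: eq_Rintegral => x _.
by rewrite normrM (ger0_norm (powR_ge0 _ _)).
Qed.

Lemma continuous_normr_comp (h : R -> R) : continuous h -> continuous (fun x => `|h x|).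
Proof. by move=> ch x; apply: cvg_norm; exact: ch. Qed.

Lemma abel_bound p a b s h H : 0 < p -> a <= b -> b <= s -> continuous h ->
  (forall x, a <= x <= b -> `|h x| <= H) ->
  `|abel p a b s h| <= H * (((s - a) `^ p - (s - b) `^ p) / p).
Proof.
move=> p0 ab bs ch hH; apply: (le_trans (abel_norm_le _ _ _ _)) => //.
rewrite -abel1// -abelZ//; last by move=> x; exact: cvg_cst.
apply: abel_le => //; first exact: continuous_normr_comp.
  by move=> x; rewrite /cst; exact: cvg_cst.
by move=> x xab; rewrite mulr1 hH.
Qed.

(* The two kernels are compared through their exact primitives, so that no
   estimate on [t `^ p] near [0] is needed. *)
Lemma abel_diag_holder p t s h H : 0 < p <= 1 -> 0 <= t -> t <= s -> 0 <= H ->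
  continuous h -> (forall x, 0 <= x <= s -> `|h x| <= H) ->
  `|abel p 0 s s h - abel p 0 t t h| <= 2 * H * (s - t) `^ p / p.
Proof.
move=> /andP[p0 p1] t0 ts H0 ch hH; rewrite (abel_cat p0 t0 ts (lexx s) ch).
(* The strict bound on [x] matters: zero to the power [p - 1] is 0 by convention when [p < 1], so
   the comparison fails at [x = t < s]. The integrals are therefore compared on the half-open
   interval. *)
have kle x : 0 <= x < t -> (s - x) `^ (p - 1) <= (t - x) `^ (p - 1).
  move=> /andP[x0 xt].
  have tx : 0 < t - x by rewrite subr_gt0.
  have sx : 0 < s - x by rewrite subr_gt0 (lt_le_trans xt).
  rewrite -(opprB 1 p) !powRN lef_pV2 ?posrE ?powR_gt0//.
  by apply: ge0_ler_powR; rewrite ?nnegrE ?subr_ge0 ?(ltW xt) ?(ltW (lt_le_trans xt ts)) ?lerB.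
(* Two contributions remain: the new piece [[t, s]], and the change of kernel on [[0, t]]. Up to the
   factor [H], the latter integrates to [(t^p - s^p + (s - t)^p) / p], where [t^p <= s^p]. *)
rewrite [_ + abel p t s s h]addrC -addrA -opprB.
apply: (le_trans (ler_normB _ _)).
have b1 : `|abel p t s s h| <= H * ((s - t) `^ p / p).
  apply: (le_trans (@abel_bound p t s s h H _ _ _ _ _)) => //.
    by move=> x /andP[tx xs]; apply: hH; rewrite xs (le_trans t0).
  by rewrite subrr powR0 ?gt_eqF// subr0.
have b2 : `|abel p 0 t t h - abel p 0 t s h| <= H * ((s - t) `^ p / p).
  rewrite /abel -RintegralB//; try exact: integrable_abel.
  have ih : mu.-integrable `[0, t] (EFin \o
      (fun x => (t - x) `^ (p - 1) * h x - (s - x) `^ (p - 1) * h x)).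
    by apply: integrable_EFinB => //; exact: integrable_abel.
  have ik0 : mu.-integrable `[0, t] (EFin \o
      (fun x => (t - x) `^ (p - 1) - (s - x) `^ (p - 1))).
    by apply: integrable_EFinB => //; exact: integrable_subl_powR.
  have ik : mu.-integrable `[0, t] (EFin \o
      (fun x => H * ((t - x) `^ (p - 1) - (s - x) `^ (p - 1)))).
    exact: (@integrableZl _ _ _ mu _ (measurable_itv _) H _ ik0).
  have co (g : R -> R) : mu.-integrable `[0, t] (EFin \o g) ->
      mu.-integrable `[0, t[ (EFin \o g).
    by apply: integrableS => //; exact: subset_itv_co_cc.
  apply: (le_trans (le_normr_Rintegral _ _)) => //.
  apply: (@le_trans _ _ (\int[mu]_(x in `[0, t])
      (H * ((t - x) `^ (p - 1) - (s - x) `^ (p - 1))))).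
    rewrite -!Rintegral_itv_bndo_bndc//; try exact: co; last first.
      by apply: co; exact: (integrable_norm ih).
    apply: le_Rintegral => //; try exact: co.
      by apply: co; exact: (integrable_norm ih).
    move=> x /=; rewrite in_itv/= => /andP[x0 xt].
    rewrite -mulrBl normrM mulrC [X in _ * X]ger0_norm ?subr_ge0 ?kle ?x0//.
    by rewrite ler_wpM2r ?subr_ge0 ?kle ?x0// hH// x0 (le_trans (ltW xt)).
  rewrite RintegralZl//.
  rewrite RintegralB//; try exact: integrable_subl_powR.
  rewrite !integral_subl_powR// !subr0 subrr powR0 ?gt_eqF// subr0.
  apply: ler_wpM2l => //; rewrite -mulrBl ler_wpM2r ?invr_ge0 ?(ltW p0)//.
  have : t `^ p <= s `^ p.
    by apply: ge0_ler_powR; rewrite ?nnegrE ?(ltW p0) ?t0 ?(le_trans t0 ts).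
  by lra.
by apply: (le_trans (lerD b1 b2)); rewrite -mulrDr -[X in _ * X]mulr2n; lra.
Qed.

End AbelKernel.

(** * Gronwall's inequality in a weighted norm *)

Section Bielecki.
Context {R : realType}.
Notation mu := (@lebesgue_measure R).
Implicit Types (p a b c s t x k H D M lam : R) (h d : R -> R).

Lemma continuous_bounded_segment a b h : continuous h ->
  exists2 H, 0 <= H & forall x, a <= x <= b -> `|h x| <= H.
Proof.
move=> ch; have [ab|ba] := leP a b; last first.
  by exists 0 => // x /andP[ax xb]; move: (le_trans ax xb); rewrite leNgt ba.
have [||c cab cmax] := @EVT_max R (fun x => `|h x|) a b => //.
  by apply: continuous_subspaceT; exact: continuous_normr_comp.
by exists `|h c| => // x xab; apply: cmax; rewrite in_itv.
Qed.

Lemma abel_diag_le0 p t h : t <= 0 -> abel p 0 t t h = 0.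
Proof.
rewrite le_eqVlt => /predU1P[->|t0]; first by rewrite /abel set_itv1 Rintegral_set1.
by rewrite /abel set_itv_ge ?bnd_simp -?ltNge// Rintegral_set0.
Qed.

Lemma continuous_abel_diag p h : 0 < p <= 1 -> continuous h ->
  continuous (fun t => abel p 0 t t h).
Proof.
move=> p01 ch t.
(* The integral vanishes for negative times, so it depends on [u] only through [max 0 u]; this
   carries the Holder estimate to the whole line. *)
pose P (u : R) : R := Num.max 0 u.
have DP u : abel p 0 u u h = abel p 0 (P u) (P u) h.
  rewrite /P; have [u0|u0] := leP u 0; last by [].
  by rewrite !abel_diag_le0.
have cP : continuous P.
  by move=> u; apply: continuous_max => //; exact: cvg_cst.
have [H H0 hH] := @continuous_bounded_segment 0 (P t + 1) h ch.
have [p0 p1] := andP p01.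
have key u : P u <= P t + 1 ->
    `|abel p 0 t t h - abel p 0 u u h| <= 2 * H * `|P u - P t| `^ p / p.
  move=> Pu1; rewrite (DP t) (DP u).
  have P0 v : 0 <= P v by rewrite /P le_max lexx.
  have [tu|ut] := leP (P t) (P u).
    rewrite distrC [X in _ * X `^ _]ger0_norm ?subr_ge0//.
    apply: abel_diag_holder => // x /andP[x0 xu]; apply: hH.
    by rewrite x0 (le_trans xu).
  rewrite [X in _ * X `^ _]distrC [X in _ * X `^ _]ger0_norm ?subr_ge0 ?(ltW ut)//.
  apply: abel_diag_holder => //; first exact: ltW.
  move=> x /andP[x0 xu]; apply: hH.
  by rewrite x0 (le_trans xu)// lerDl.
have c0 : (fun u => 2 * H * `|P u - P t| `^ p / p) @ t --> (0 : R).
  have -> : (0 : R) = 2 * H * 0 / p by rewrite mulr0 mul0r.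
  apply: cvgMl; apply: cvgMr.
  have := powR_continuous0 p0.
  rewrite /prop_for /continuous_at normr0 powR0 ?gt_eqF// => h0.
  apply: (@cvg_comp _ _ _ (fun u => P u - P t) (fun x => `|x| `^ p) _ _ _ _ h0).
  have -> : nbhs (0 : R) = nbhs (P t - P t) by rewrite subrr.
  by apply: cvgB; [exact: cP|exact: cvg_cst].
apply/cvgrPdist_le => /= e e0; near=> u.
apply: le_trans (key u _) _.
  rewrite -lerBlDl; apply: le_trans (ler_norm _) _.
  near: u; move/cvgrPdist_le : (cP t) => /(_ 1 ltr01).
  by apply: filterS => u; rewrite distrC.
apply: le_trans (ler_norm _) _; near: u.
by move/cvgr0Pnorm_le : c0 => /(_ e e0).
Unshelve. all: by end_near. Qed.

Lemma powR_le_expR (y q : R) : 0 <= y -> 0 < q <= 1 -> y `^ q <= expR y.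
Proof.
move=> y0 /andP[q0 q1]; have [y1|y1] := leP 1 y.
  apply: le_trans (ler1_powR y1 q1) _; apply: le_trans _ (expR_ge1Dx y).
  by rewrite lerDr.
apply: (@le_trans _ _ 1); last by rewrite -expR0 ler_expR.
have -> : 1 = 1 `^ q :> R by rewrite powR1.
by apply: ge0_ler_powR; rewrite ?nnegrE//; exact: ltW.
Qed.

Lemma continuous_expRM lam : continuous (fun x : R => expR (lam * x)).
Proof.
move=> x; apply: (@continuous_comp _ _ _ (fun x => lam * x) (@expR R)).
  exact: mulrl_continuous.
exact: continuous_expR.
Qed.

(** For large [lam], [M] times Abel integration contracts by 1/2 in the weighted norm. With
    [u = t - x] and [q = p / 2], the bound [(lam u)^q <= exp(lam u)] gives
    [u^(p-1) exp(- lam u) <= lam^(-q) u^(q-1)]: half of the exponent is spent on a small factor, and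
    the rest is still integrable. *)
Lemma bielecki p M b : 0 < p < 1 -> 0 <= M -> 0 <= b ->
  exists2 lam, 0 < lam & forall t, 0 <= t <= b ->
    M * abel p 0 t t (fun x => expR (lam * x)) <= expR (lam * t) / 2.
Proof.
move=> /andP[p0 p1] M0 b0; pose q := p / 2.
have q0 : 0 < q by rewrite divr_gt0.
have q1 : q <= 1 by rewrite /q; lra.
(* This is the value intended for [lam^q]: the integral of [u^(q-1)] is at most [b^q / q], and
   [M * b^q / q] has to stay below [lq / 2]. *)
pose lq := 2 * M * b `^ q / q + 1.
have lq0 : 0 < lq.
  by rewrite /lq ltr_wpDl// divr_ge0 ?(ltW q0)// !mulr_ge0// powR_ge0.
pose lam := lq `^ q^-1.
have lam0 : 0 < lam by exact: powR_gt0.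
have lamq : lam `^ q = lq by rewrite /lam -powRrM mulVf ?gt_eqF// powRr1// ltW.
exists lam => // t /andP[t0 tb].
have pt x : 0 <= x <= t -> (t - x) `^ (p - 1) * expR (lam * x) <=
    (expR (lam * t) / lq) * (t - x) `^ (q - 1).
  move=> /andP[x0 xt]; have [<-|xt'] := eqVneq x t.
    have pn : p - 1 != 0 by rewrite lt_eqF// subr_lt0.
    have qn : q - 1 != 0 by rewrite lt_eqF// subr_lt0 /q; lra.
    by rewrite subrr !powR0// mul0r mulr0.
  have u0 : 0 < t - x by rewrite subr_gt0 lt_neqAle xt'.
  set u := t - x in u0 *.
  have -> : x = t - u by rewrite /u; ring.
  have -> : p - 1 = q + (q - 1) by rewrite /q; field.
  rewrite powRD; last by rewrite (gt_eqF u0) implybT.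
  rewrite mulrAC ler_wpM2r ?powR_ge0// mulrBr expRD expRN mulrCA.
  rewrite ler_wpM2l ?expR_ge0// ler_pdivrMr ?expR_gt0// ler_pdivlMl//.
  rewrite -lamq -powRM ?(ltW lam0) ?(ltW u0)//.
  by apply: powR_le_expR; rewrite ?mulr_ge0 ?(ltW lam0) ?(ltW u0)// q0.
have ce := @continuous_expRM lam.
have : abel p 0 t t (fun x => expR (lam * x)) <=
    \int[mu]_(x in `[0, t]) (expR (lam * t) / lq * (t - x) `^ (q - 1)).
  apply: le_Rintegral => //; first exact: integrable_abel.
  have := @integrableZl _ _ _ mu `[0, t]%classic (measurable_itv _)
    (expR (lam * t) / lq) _ (integrable_subl_powR 0 q0 (lexx t)).
  by apply: eq_integrable => // x _ /=; rewrite EFinM.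
rewrite RintegralZl//; last exact: integrable_subl_powR.
rewrite integral_subl_powR// subr0 subrr powR0 ?gt_eqF// subr0 => le1.
apply: le_trans (ler_wpM2l M0 le1) _.
rewrite -mulrA mulrCA ler_wpM2l ?expR_ge0// mulrC -mulrA.
rewrite ler_pdivrMl//.
have tbq : t `^ q <= b `^ q.
  by apply: ge0_ler_powR; rewrite ?nnegrE// ltW.
have : t `^ q / q * M <= b `^ q / q * M.
  by rewrite ler_wpM2r// ler_wpM2r// invr_ge0 ltW.
by rewrite /lq; lra.
Qed.

(** At a point [c] where [exp(- lam t) |d t|] attains its maximum [S], the hypotheses give
    [|d c| <= D + |d c| / 2], hence [|d c| <= 2 D]; and [S <= |d c|] since [c >= 0]. *)
Lemma abel_gronwall p M b lam D d : 0 < p -> 0 <= M -> 0 <= D -> 0 < lam ->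
  (forall t, 0 <= t <= b ->
    M * abel p 0 t t (fun x => expR (lam * x)) <= expR (lam * t) / 2) ->
  continuous d ->
  (forall t, 0 <= t <= b -> `|d t| <= D + M * abel p 0 t t (fun x => `|d x|)) ->
  forall t, 0 <= t <= b -> `|d t| <= 2 * D * expR (lam * t).
Proof.
move=> p0 M0 D0 lam0 hlam cd hd t tb.
have b0 : 0 <= b by have /andP[/le_trans H /H] := tb.
have cd1 := continuous_normr_comp cd.
have ce := continuous_expRM.
have [||c cb cmax] := @EVT_max R (fun x => expR ((- lam) * x) * `|d x|) 0 b => //.
  by apply: continuous_subspaceT => x; apply: cvgM; [exact: ce|exact: cd1].
set S := expR _ * _ in cmax.
have S0 : 0 <= S by rewrite mulr_ge0// expR_ge0.
have dS x : 0 <= x <= b -> `|d x| <= S * expR (lam * x).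
  move=> xb; have := cmax x; rewrite in_itv/= => /(_ xb).
  by rewrite mulNr expRN ler_pdivrMl ?expR_gt0// mulrC.
rewrite in_itv/= in cb.
have dc : `|d c| = S * expR (lam * c).
  by rewrite /S mulNr mulrAC expRN mulVf ?mul1r// gt_eqF// expR_gt0.
have : `|d c| <= 2 * D.
  have [c0 cb'] := andP cb.
  have : abel p 0 c c (fun x => `|d x|) <=
      S * abel p 0 c c (fun x => expR (lam * x)).
    rewrite -abelZ//; apply: abel_le => //.
      by move=> x; apply: cvgMr; exact: ce.
    by move=> x /andP[x0 xc]; apply: dS; rewrite x0 (le_trans xc).
  move=> /(ler_wpM2l M0); rewrite mulrCA => h1.
  have h2 := ler_wpM2l S0 (hlam c cb).
  rewrite [X in _ <= X]mulrA -dc in h2.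
  have := hd c cb; move: h1 h2.
  by move: (M * _) (S * _) => X Y; lra.
rewrite dc => SD.
apply: le_trans (dS t tb) _; rewrite ler_wpM2r ?expR_ge0//.
apply: le_trans SD; rewrite ler_peMr// -expR0 ler_expR mulr_ge0 ?(ltW lam0)//.
by have [] := andP cb.
Qed.

End Bielecki.

(** * The Volterra equation *)

Lemma continuous_comp2 (X U V W : topologicalType) (h : U -> V -> W)
    (a : X -> U) (b : X -> V) :
  continuous (fun z : U * V => h z.1 z.2) -> continuous a -> continuous b ->
  continuous (fun x => h (a x) (b x)).
Proof.
move=> ch ca cb x.
apply: (@continuous_comp _ _ _ (fun x => (a x, b x)) (fun z : U * V => h z.1 z.2)).
  exact: (cvg_pair (ca x) (cb x)).
exact: ch.
Qed.

Lemma le_geometric_le0 (R : realType) (a C : R) :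
  (forall n : nat, a <= C * (2^-1) ^+ n) -> a <= 0.
Proof.
move=> h; have c0 : (fun n => C * (2^-1) ^+ n) @ \oo --> (0 : R).
  have -> : (0 : R) = C * 0 by rewrite mulr0.
  by apply: cvgMr; apply: cvg_expr; rewrite ger0_norm// invf_lt1// ltr1n.
rewrite -(cvg_lim _ c0)//; apply: limr_ge; first by apply/cvg_ex; exists 0.
exact: nearW.
Qed.

Lemma geometric_increments_cvg (R : realType) (u : nat -> R) (K : R) :
  (forall n, `|u n.+1 - u n| <= K * (2^-1) ^+ n) ->
  forall n, `|limn u - u n| <= 2 * K * (2^-1) ^+ n.
Proof.
move=> hu.
have h0 n : 0 < (2^-1 : R) ^+ n by rewrite exprn_gt0.
have hS n : (2^-1 : R) ^+ n.+1 = (2^-1) ^+ n / 2 by rewrite exprS mulrC.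
have step m n : `|u (n + m)%N - u n| <= 2 * K * (2^-1) ^+ n - 2 * K * (2^-1) ^+ (n + m).
  elim: m => [|m IH]; first by rewrite addn0 !subrr normr0.
  rewrite addnS hS; have := hu (n + m)%N.
  have -> : u (n + m).+1 - u n = (u (n + m).+1 - u (n + m)%N) + (u (n + m)%N - u n).
    by rewrite addrA subrK.
  move=> h1; apply: le_trans (ler_normD _ _) _; move: IH h1.
  by move: (2^-1 ^+ n) (2^-1 ^+ (n + m)) `|_| `|_| => X Y A B; lra.
have K0 : 0 <= K.
  by have := hu 0%N; rewrite expr0 mulr1; apply: le_trans.
have gK0 : (fun n => 2 * K * (2^-1) ^+ n) @ \oo --> (0 : R).
  have -> : (0 : R) = 2 * K * 0 by rewrite mulr0.
  by apply: cvgMr; apply: cvg_expr; rewrite ger0_norm// invf_lt1// ltr1n.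
have cu : cvgn u.
  (* Shifted by the bound on its tail, the sequence is nondecreasing and bounded above, hence
     convergent. *)
  pose v n := u n - 2 * K * (2^-1) ^+ n.
  have cv : cvgn v.
    apply: nondecreasing_is_cvgn.
      apply/nondecreasing_seqP => n; rewrite /v hS.
      by have := hu n; rewrite ler_norml => /andP[+ _]; move: (2^-1 ^+ n) => X; lra.
    exists (u 0%N + 2 * K) => _ [n _ <-]; rewrite /v.
    have := step n 0%N; rewrite add0n expr0 mulr1 ler_norml => /andP[_].
    by have := mulr_ge0 K0 (ltW (h0 n)); move: (2^-1 ^+ n) => X; lra.
  have -> : u = (fun n => v n + 2 * K * (2^-1) ^+ n).
    by apply/funext => n; rewrite /v subrK.
  by apply: is_cvgD => //; apply/cvg_ex; exists 0.
move=> n; have cun : (fun m => `|u m - u n|) @ \oo --> `|limn u - u n|.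
  by apply: cvg_norm; apply: cvgB => //; exact: cvg_cst.
apply: (cvgr_to_le cun); exists n => // m /= nm; have := step (m - n)%N n; rewrite subnKC//.
by move=> /le_trans; apply; rewrite gerBl mulr_ge0// mulr_ge0.
Qed.

Section Volterra.
Context {R : realType}.
Variables (p : R) (g : R -> R -> R) (L : R -> R).
Implicit Types (b t s M lam K : R).
Hypothesis p01 : 0 < p < 1.
Hypothesis cg : continuous (fun z : R * R => g z.1 z.2).
Hypothesis cL : continuous L.
Hypothesis lip : forall t x y, `|g t x - g t y| <= L t * `|x - y|.

Let p0 : 0 < p. Proof. by have /andP[] := p01. Qed.
Let p1 : 0 < p <= 1. Proof. by have /andP[-> /ltW] := p01. Qed.

Lemma continuous_nemytskii (x : R -> R) : continuous x -> continuous (fun t => g t (x t)).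
Proof. by move=> cx; apply: (continuous_comp2 cg) => // t; exact: cvg_id. Qed.

Lemma volterra_increment (x y : R -> R) (M t : R) :
  0 <= t -> continuous x -> continuous y -> (forall s, 0 <= s <= t -> L s <= M) ->
  `|abel p 0 t t (fun s => g s (x s)) - abel p 0 t t (fun s => g s (y s))| <=
  M * abel p 0 t t (fun s => `|x s - y s|).
Proof.
move=> t0 cx cy LM.
have cgx := continuous_nemytskii cx; have cgy := continuous_nemytskii cy.
have cxy : continuous (fun s => x s - y s).
  by move=> s; apply: cvgB; [exact: cx|exact: cy].
have cgxy : continuous (fun s => g s (x s) - g s (y s)).
  by move=> s; apply: cvgB; [exact: cgx|exact: cgy].
have cn := continuous_normr_comp cxy.
rewrite -abelB//; apply: le_trans (abel_norm_le _ _ _ _) _ => //.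
rewrite -abelZ//; apply: abel_le => //.
- exact: continuous_normr_comp.
- by move=> s; apply: cvgMr; exact: cn.
- move=> s st; apply: le_trans (lip _ _ _) _.
  by rewrite ler_wpM2r// LM.
Qed.

Definition volterra_sol (b x0 : R) (x : R -> R) : Prop :=
  continuous x /\
  forall t, 0 <= t <= b -> x t = x0 + abel p 0 t t (fun s => g s (x s)).

Lemma lipschitz_bound (b : R) :
  exists2 M, 0 <= M & forall s, 0 <= s <= b -> L s <= M.
Proof.
have [M M0 hM] := continuous_bounded_segment 0 b cL.
by exists M => // s sb; exact: le_trans (ler_norm _) (hM s sb).
Qed.

(** The rate [lam] is fixed before the solutions, from [b] and a bound of [L] alone, so that one
    Lipschitz constant serves all initial values. *)
Lemma volterra_dependence (b : R) : 0 <= b ->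
  exists2 lam, 0 < lam & forall x0 y0 x y,
    volterra_sol b x0 x -> volterra_sol b y0 y ->
    forall t, 0 <= t <= b -> `|x t - y t| <= 2 * `|x0 - y0| * expR (lam * t).
Proof.
move=> b0; have [M M0 hM] := lipschitz_bound b.
have [lam lam0 hlam] := bielecki p01 M0 b0.
exists lam => // x0 y0 x y [cx ex] [cy ey].
apply: (@abel_gronwall R p M b lam `|x0 - y0| (fun t => x t - y t)) => //.
  by move=> s; apply: cvgB; [exact: cx|exact: cy].
move=> t tb; rewrite ex// ey// opprD addrACA.
have [t0 tb'] := andP tb.
apply: le_trans (ler_normD _ _) _; rewrite lerD2l; apply: volterra_increment => //.
by move=> s /andP[s0 st]; apply: hM; rewrite s0 (le_trans st).
Qed.

Lemma volterra_unique (b x0 : R) (x y : R -> R) :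
  volterra_sol b x0 x -> volterra_sol b x0 y ->
  forall t, 0 <= t <= b -> x t = y t.
Proof.
move=> hx hy t tb.
have b0 : 0 <= b by have /andP[/le_trans H /H] := tb.
have [lam _ /(_ x0 x0 x y hx hy t tb)] := volterra_dependence b0.
by rewrite subrr normr0 mulr0 mul0r normr_le0 subr_eq0 => /eqP.
Qed.

Fixpoint picard (x0 : R) (n : nat) : R -> R :=
  if n is n'.+1 then fun t => x0 + abel p 0 t t (fun s => g s (picard x0 n' s))
  else fun=> x0.

Lemma continuous_picard x0 n : continuous (picard x0 n).
Proof.
elim: n => [|n IH] /= t; first exact: cvg_cst.
apply: cvgD; first exact: cvg_cst.
by apply: continuous_abel_diag => //; exact: continuous_nemytskii.
Qed.

Lemma picard_le0 x0 n t : t <= 0 -> picard x0 n t = x0.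
Proof. by case: n => //= n t0; rewrite abel_diag_le0// addr0. Qed.

Lemma picard_increment x0 b : 0 <= b ->
  exists K, forall n t, t <= b ->
    `|picard x0 n.+1 t - picard x0 n t| <= K * (2^-1) ^+ n.
Proof.
move=> b0; have [M M0 hM] := lipschitz_bound b.
have [lam lam0 hlam] := bielecki p01 M0 b0.
have cd n : continuous (fun t => picard x0 n.+1 t - picard x0 n t).
  by move=> t; apply: cvgB; exact: continuous_picard.
have [K K0 hK] := continuous_bounded_segment 0 b (cd 0%N).
have ce := @continuous_expRM R lam.
(* Each Picard step halves the increment in the weighted norm; [K] bounds the first increment on
   [[0, b]]. *)
have key n t : 0 <= t <= b ->
    `|picard x0 n.+1 t - picard x0 n t| <= K * (2^-1) ^+ n * expR (lam * t).
  elim: n t => [|n IH] t tb.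
    rewrite expr0 mulr1; apply: le_trans (hK t tb) _.
    rewrite ler_peMr// -expR0 ler_expR mulr_ge0 ?(ltW lam0)//.
    by have [] := andP tb.
  have [t0 tb'] := andP tb.
  rewrite [picard x0 n.+2]/= [X in _ - X]/= opprD addrACA subrr add0r.
  apply: le_trans (@volterra_increment (picard x0 n.+1) (picard x0 n) M t _ _ _ _) _ => //.
  - exact: continuous_picard.
  - exact: continuous_picard.
  - by move=> s /andP[s0 st]; apply: hM; rewrite s0 (le_trans st).
  have : abel p 0 t t (fun s => `|picard x0 n.+1 s - picard x0 n s|) <=
      K * (2^-1) ^+ n * abel p 0 t t (fun s => expR (lam * s)).
    rewrite -abelZ//; apply: abel_le => //.
    - exact: (continuous_normr_comp (cd n)).
    - by move=> s; apply: cvgMr; exact: ce.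
    - by move=> s /andP[s0 st]; apply: IH; rewrite s0 (le_trans st).
  move=> /(ler_wpM2l M0)/le_trans; apply.
  rewrite mulrCA exprSr -!mulrA ler_wpM2l// ler_wpM2l ?exprn_ge0//.
  by rewrite [leRHS]mulrC; exact: hlam.
exists (K * expR (lam * b)) => n t tb.
have [t0|t0] := leP t 0.
  rewrite !picard_le0// subrr normr0 mulr_ge0 ?exprn_ge0//.
  by rewrite mulr_ge0 ?expR_ge0.
apply: le_trans (key n t _) _; first by rewrite (ltW t0).
rewrite mulrAC ler_wpM2r ?exprn_ge0// ler_wpM2l// ler_expR.
by rewrite ler_wpM2l// ltW.
Qed.

(** The Picard iterates converge uniformly on every half-line bounded above, so the limit is
    continuous. Its residual in the equation is at most a constant times [2^-n] for every [n], hence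
    zero. *)
Lemma volterra_exists (x0 : R) :
  exists x : R -> R, continuous x /\
    forall t, x t = x0 + abel p 0 t t (fun s => g s (x s)).
Proof.
pose x t := limn (fun n => picard x0 n t).
have hx b : 0 <= b -> exists2 K, 0 <= K & forall n t, t <= b ->
    `|x t - picard x0 n t| <= K * (2^-1) ^+ n.
  move=> b0; have [K hK] := picard_increment x0 b0.
  have K0 : 0 <= K by have := hK 0%N b (lexx b); rewrite expr0 mulr1; apply: le_trans.
  exists (2 * K); first by rewrite mulr_ge0.
  move=> n t tb; apply: (@geometric_increments_cvg R (fun n => picard x0 n t)) => m.
  exact: hK.
have cx : continuous x.
  move=> t; apply/cvgrPdist_lt => /= e e0.
  have b0 : 0 <= `|t| + 1 by rewrite addr_ge0.
  have [K K0 hK] := hx _ b0.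
  have [n hn] : exists n, K * (2^-1) ^+ n < e / 3.
    apply: contrapT => /forallNP h; suff : e / 3 <= 0 by lra.
    by apply: (@le_geometric_le0 _ _ K) => n; rewrite leNgt; apply/negP.
  near=> s.
  have sb : s <= `|t| + 1.
    have : `|t - s| < 1 by near: s; apply: cvgr_dist_lt => //; exact: cvg_id.
    by have := ler_norm t; rewrite distrC ltr_distl => ? /andP[_]; lra.
  have tb : t <= `|t| + 1 by have := ler_norm t; lra.
  have h1 := hK n t tb; have h2 := hK n s sb.
  have h3 : `|picard x0 n t - picard x0 n s| < e / 3.
    near: s; have := @continuous_picard x0 n t.
    by move=> /cvgrPdist_lt; apply; rewrite divr_gt0.
  rewrite distrC in h2.
  have -> : x t - x s = (x t - picard x0 n t) + (picard x0 n t - picard x0 n s)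
     + (picard x0 n s - x s) by rewrite !subrKA.
  apply: le_lt_trans (ler_normD _ _) _.
  apply: le_lt_trans (lerD (ler_normD _ _) (lexx _)) _.
  move: h1 h2 h3; move: `|_| `|_| `|_| => A B C; move: hn.
  by move: (K * _) => D; lra.
exists x; split=> // t; apply/eqP; rewrite -subr_eq0 -normr_le0.
have b0 : 0 <= Num.max 0 t by rewrite le_max lexx.
have tb : t <= Num.max 0 t by rewrite le_max lexx orbT.
have [K K0 hK] := hx _ b0; have [M M0 hM] := lipschitz_bound (Num.max 0 t).
have [t0|t0] := leP t 0.
  rewrite abel_diag_le0// addr0; apply: (@le_geometric_le0 _ _ K) => n.
  by have := hK n t tb; rewrite picard_le0.
have tmax : Num.max 0 t = t by rewrite max_r// ltW.
rewrite tmax in hK hM.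
(* The first summand accounts for the distance from [x] to iterate [n + 1], the second for the Abel
   integral of the distance to iterate [n]. *)
apply: (@le_geometric_le0 _ _ (K + M * (K * (t `^ p / p)))) => n.
have h1 := hK n.+1 t (lexx t).
have h2 := @volterra_increment (picard x0 n) x M t (ltW t0) (@continuous_picard x0 n) cx hM.
have h3 : abel p 0 t t (fun s => `|picard x0 n s - x s|) <= K * (2^-1) ^+ n * (t `^ p / p).
  apply: le_trans (ler_norm _) _.
  have := @abel_bound R p 0 t t (fun s => `|picard x0 n s - x s|) (K * (2^-1) ^+ n).
  rewrite subrr subr0 powR0 ?gt_eqF// subr0; apply => //.
  - exact: ltW.
  - apply: continuous_normr_comp => s.
    by apply: cvgB; [exact: continuous_picard|exact: cx].
  - by move=> s /andP[_ st]; rewrite normr_id distrC hK.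
have -> : x t - (x0 + abel p 0 t t (fun s => g s (x s))) =
  (x t - picard x0 n.+1 t) + (abel p 0 t t (fun s => g s (picard x0 n s)) -
    abel p 0 t t (fun s => g s (x s))).
  rewrite [picard x0 n.+1 t]/=; move: (abel _ _ _ _ _) (abel _ _ _ _ _) => X Y.
  by rewrite !opprD !addrA subrK.
apply: le_trans (ler_normD _ _) _.
rewrite mulrDl; apply: lerD.
  apply: le_trans h1 _; rewrite exprS ler_wpM2l// ler_piMl ?exprn_ge0//.
  by rewrite invf_le1// ler1n.
apply: le_trans h2 _; rewrite -!mulrA ler_wpM2l//.
by apply: le_trans h3 _; rewrite -!mulrA [2^-1 ^+ n * _]mulrC -mulrA.
Unshelve. all: by end_near. Qed.

End Volterra.

(** * A lower bound for nonnegative solutions *)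

Section RealPowers.
Context {R : realType}.
Implicit Types (p q y a b d e k : R).

Lemma exists_small_powR p k e : 0 < p -> 0 < k -> 0 < e ->
  exists2 d, 0 < d <= k & d `^ p <= e.
Proof.
move=> p0 k0 e0; exists (Num.min k (e `^ p^-1)).
  by rewrite lt_min k0 powR_gt0//= ge_min lexx.
rewrite -[leRHS]powRr1 ?(ltW e0)// -[X in _ <= _ `^ X](@mulVf _ p) ?gt_eqF// powRrM.
apply: ge0_ler_powR; rewrite ?nnegrE ?powR_ge0 ?(ltW p0)//.
  by rewrite le_min (ltW k0) powR_ge0.
by rewrite ge_min lexx orbT.
Qed.

Lemma powR_le1 q a : 0 <= q -> 0 <= a <= 1 -> a `^ q <= 1.
Proof.
move=> q0 /andP[a0 a1]; have <- : 1 `^ q = 1 :> R by rewrite powR1.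
by apply: ge0_ler_powR; rewrite ?nnegrE.
Qed.

Lemma powR_lt1 q a : 0 < q -> 0 <= a < 1 -> a `^ q < 1.
Proof.
move=> q0 /andP[a0 a1]; have <- : 1 `^ q = 1 :> R by rewrite powR1.
by apply: gt0_ltr_powR; rewrite ?nnegrE.
Qed.

(** From [1 - y <= exp(- y)], the power is at most [exp(- q y) <= 1 / (1 + q y)], and this is at
    most [1 - q y / 2] because [q y <= 1]. *)
Lemma powR_onem_le q y : 0 < q <= 1 -> 0 <= y < 1 ->
  (1 - y) `^ q <= 1 - q * y / 2.
Proof.
move=> /andP[q0 q1] /andP[y0 y1].
have y1' : 0 < 1 - y by rewrite subr_gt0.
rewrite /powR gt_eqF//.
have h1 : ln (1 - y) <= - y by apply: le_ln1Dx; rewrite ltrN2.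
have h2 : q * ln (1 - y) <= - (q * y) by rewrite -mulrN ler_wpM2l// ltW.
apply: (@le_trans _ _ (expR (- (q * y)))); first by rewrite ler_expR.
have qy0 : 0 <= q * y by rewrite mulr_ge0// ltW.
have qy1 : q * y <= 1 by rewrite mulr_ile1// ltW.
rewrite expRN; apply: (@le_trans _ _ (1 + q * y)^-1).
  by rewrite lef_pV2 ?posrE ?expR_gt0 ?expR_ge1Dx// ltr_wpDr.
rewrite -[leLHS]mul1r ler_pdivrMr ?ltr_wpDr//.
by move: (q * y) qy0 qy1 => z z0 z1; nra.
Qed.

(** With [a = t - x] and [b = s - x], the right side is the Abel kernel at [s] divided by the kernel
    at [t]. *)
Lemma powR_ratio p a b : 0 <= a -> 0 < b ->
  (a / b) `^ (1 - p) = a `^ (1 - p) * b `^ (p - 1).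
Proof.
move=> a0 b0; rewrite powRM ?invr_ge0 ?(ltW b0)//; congr (_ * _).
by rewrite -powR_inv1 ?(ltW b0)// -powRrM mulN1r opprB.
Qed.

Lemma is_derive_powR_ratio (p t s x : R) : x < t -> t < s -> 0 < p < 1 ->
  exists2 r', r' <= 0 &
    is_derive x 1 (fun y : R => ((t - y) / (s - y)) `^ (1 - p)) r'.
Proof.
move=> xt ts /andP[p0 p1].
have xs := lt_trans xt ts.
have dt := is_derive_subl_powR (1 - p) xt.
have ds := is_derive_subl_powR (p - 1) xs.
have dm := is_deriveM dt ds.
have a0 : 0 < t - x by rewrite subr_gt0.
have b0 : 0 < s - x by rewrite subr_gt0.
eexists; last first.
  apply: near_eq_is_derive dm; near=> y.
  have yt : y < t by near: y; exact: lt_nbhsl.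
  rewrite powR_ratio ?subr_ge0 ?(ltW yt)// subr_gt0.
  exact: lt_trans ts.
rewrite /GRing.scale/=.
have -> : (t - x) `^ (1 - p - 1) = (t - x) `^ (1 - p) / (t - x).
  by rewrite powRB ?(gt_eqF a0) ?implybT// powRr1// ltW.
have -> : (s - x) `^ (p - 1 - 1) = (s - x) `^ (p - 1) / (s - x).
  by rewrite powRB ?(gt_eqF b0) ?implybT// powRr1// ltW.
have ab : (s - x)^-1 <= (t - x)^-1 by rewrite lef_pV2 ?posrE// lerB// ltW.
set X := (t - x) `^ _; set Y := (s - x) `^ _.
have XY : 0 <= (1 - p) * (X * Y) by rewrite !mulr_ge0 ?powR_ge0// subr_ge0 ltW.
have -> : X * - ((p - 1) * (Y / (s - x))) + Y * - ((1 - p) * (X / (t - x))) =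
    (1 - p) * (X * Y) * ((s - x)^-1 - (t - x)^-1) by ring.
by rewrite mulr_ge0_le0// subr_le0.
Unshelve. all: by end_near. Qed.

End RealPowers.

(** * Values predicted from the past of an Abel equation *)

Section Memory.
Context {R : realType}.
Notation mu := (@lebesgue_measure R).
Variables (p : R) (F : R -> R) (w0 : R).
Hypothesis p01 : 0 < p < 1.
Hypothesis cF : continuous F.
Implicit Types (s t x sg m : R).

Let p0 : 0 < p. Proof. by have /andP[] := p01. Qed.

Let A x s := w0 + abel p 0 x s F.

Lemma is_derive_abel_end x s : 0 < x -> x < s ->
  is_derive x 1 (fun y => abel p 0 y s F) ((s - x) `^ (p - 1) * F x).
Proof.
move=> x0 xs.
have [|dA dAE] := @continuous_FTC1_closed R (fun y => (s - y) `^ (p - 1) * F y)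
    0 x s xs (integrable_abel 0 p0 (lexx s) cF) x0.
  by apply: cvgM; [exact: continuous_subl_powR|exact: cF].
rewrite /abel; split; first exact: dA.
by rewrite -derive1E; exact: dAE.
Qed.

Lemma within_continuous_abel_end b s : 0 <= b -> b <= s ->
  {within `[0, b], continuous (fun y => abel p 0 y s F)}.
Proof.
by move=> b0 bs; apply: parameterized_integral_continuous => //; exact: integrable_abel.
Qed.

(* The function [A x s - r x * (A x t - m)], where [r x] is the quotient of the
   kernels at [s] and [t], has derivative [- r' x * (A x t - m) >= 0]: the
   contribution of [F] cancels. *)
Lemma memory_comparison sg t s m : 0 <= sg -> sg < t -> t < s ->
  (forall x, 0 <= x <= sg -> m <= A x t) ->
  w0 - (t / s) `^ (1 - p) * (w0 - m)
    + ((t - sg) / (s - sg)) `^ (1 - p) * (A sg t - m) <= A sg s.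
Proof.
move=> sg0 sgt ts hm.
pose r x := ((t - x) / (s - x)) `^ (1 - p).
pose N x := A x s - r x * (A x t - m).
have dN x : x \in `]0, sg[ -> exists2 N', 0 <= N' & is_derive x 1 N N'.
  rewrite in_itv/= => /andP[x0 xsg].
  have xt := lt_trans xsg sgt; have xs := lt_trans xt ts.
  have [r' r'0 dr] := is_derive_powR_ratio xt ts p01.
  have dAs : is_derive x 1 (A ^~ s) ((s - x) `^ (p - 1) * F x).
    have := is_deriveD (is_derive_cst w0 x 1) (is_derive_abel_end x0 xs).
    by rewrite add0r.
  have dAt : is_derive x 1 (fun y => A y t - m) ((t - x) `^ (p - 1) * F x).
    have := is_deriveB (is_deriveD (is_derive_cst w0 x 1) (is_derive_abel_end x0 xt))
      (is_derive_cst m x 1).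
    by rewrite add0r subr0.
  exists (- r' * (A x t - m)).
    by rewrite mulr_ge0 ?oppr_ge0// subr_ge0 hm// (ltW x0) (ltW xsg).
  rewrite /N; apply: is_derive_eq.
  rewrite /GRing.scale/= -/(r x).
  have -> : r x * ((t - x) `^ (p - 1) * F x) = (s - x) `^ (p - 1) * F x.
    have tx : 0 < t - x by rewrite subr_gt0.
    rewrite /r powR_ratio ?(ltW tx) ?subr_gt0// mulrACA -powRD.
      by rewrite addrA subrK subrr powRr0 mul1r.
    by rewrite (gt_eqF tx) implybT.
  by rewrite opprD addrA subrr add0r mulrC mulNr.
have cr : {within `[0, sg], continuous r}.
  apply: continuous_in_subspaceT => x; rewrite inE/= in_itv/= => /andP[_ xsg].
  have [r' _ [dr _]] := is_derive_powR_ratio (le_lt_trans xsg sgt) ts p01.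
  by apply: differentiable_continuous; apply/derivable1_diffP.
have cA u : sg <= u -> {within `[0, sg], continuous (A ^~ u)}.
  move=> sgu x; apply: cvgD; first exact: cvg_cst.
  exact: (within_continuous_abel_end sg0 sgu).
have cN : {within `[0, sg], continuous N}.
  move=> x; apply: cvgB.
    by apply: cA; rewrite ltW// (lt_trans sgt).
  apply: cvgM; first exact: cr.
  apply: cvgB; last exact: cvg_cst.
  by apply: cA; rewrite ltW.
have : N 0 <= N sg.
  apply: (@ger0_derive1_le_cc _ N 0 sg) => //.
  - by move=> x /dN[N' _ []].
  - by move=> x /dN[N' N'0 [_ dN']]; rewrite derive1E dN'.
  - by rewrite in_itv/= lexx.
  - by rewrite in_itv/= lexx andbT.
rewrite /N /r !subr0.
have A0 u : A 0 u = w0 by rewrite /A /abel set_itv1 Rintegral_set1 addr0.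
rewrite !A0.
by move: (A sg s) (A sg t) (_ `^ _) (_ `^ _) => X Y Z T; lra.
Qed.

Variables (w : R -> R) (t1 : R).
Hypothesis w0_gt0 : 0 < w0.
Hypothesis weq : forall t, 0 <= t <= t1 -> w t = A t t.
Hypothesis wge0 : forall t, 0 <= t <= t1 -> 0 <= w t.

Lemma memory_split x s : 0 <= x -> x <= s -> s <= t1 ->
  w s = A x s + abel p x s s F.
Proof.
move=> x0 xs st; rewrite weq ?(le_trans x0 xs)// /A.
by rewrite (abel_cat p0 x0 xs (lexx s) cF) addrA.
Qed.

(** Let [m] be the infimum of all predicted values [A x u]. If [m < 0], they are all at least
    [th * m] for a single [th < 1], a contradiction. Close to the diagonal this follows from
    [w u >= 0]; away from it, comparison with the midpoint [t] of [x] and [u] gives at least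
    [(t / u)^(1-p) * m]. *)
Lemma memory_ge0 sg s : 0 <= sg -> sg <= s -> s <= t1 -> 0 <= A sg s.
Proof.
move=> sg0 sgs st; rewrite leNgt; apply/negP => Alt0.
have t10 : 0 <= t1 by rewrite (le_trans sg0)// (le_trans sgs).
have [H H0 hH] := continuous_bounded_segment 0 t1 cF.
pose S := [set y | exists x u, [/\ 0 <= x, x <= u, u <= t1 & y = A x u]].
have near_diag x u : 0 <= x -> x <= u -> u <= t1 ->
    - (H * ((u - x) `^ p / p)) <= A x u.
  move=> x0 xu ut.
  have u0 := le_trans x0 xu.
  have := @abel_bound R p x u u F H p0 xu (lexx u) cF.
  rewrite subrr powR0 ?gt_eqF// subr0 => /(_ _)/ler_normlW h.
  have := memory_split x0 xu ut; have := wge0 (t := u); rewrite u0 ut => /(_ isT).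
  have {h} : abel p x u u F <= H * ((u - x) `^ p / p).
    apply: h => y /andP[xy yu]; apply: hH.
    by rewrite (le_trans x0 xy) (le_trans yu ut).
  by move: (A x u) (abel p x u u F) (H * _) => X Y Z; lra.
have lbS : has_lbound S.
  exists (- (H * (t1 `^ p / p))) => _ [x [u [x0 xu ut ->]]].
  apply: le_trans (near_diag x u x0 xu ut); rewrite lerN2 ler_wpM2l//.
  rewrite ler_wpM2r ?invr_ge0 ?(ltW p0)//.
  by apply: ge0_ler_powR; rewrite ?nnegrE ?(ltW p0) ?subr_ge0// lerBlDr ler_wpDr.
have S0 : S !=set0 by exists (A sg s), sg, s.
pose m := inf S.
have m0 : m < 0.
  by apply: le_lt_trans Alt0; apply: ge_inf => //; exists sg, s.
(* Within distance [d] of the diagonal the recent part is at most [H * d^p / p <= - m / 2]; [H + 1]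
   keeps the denominator positive. *)
have [d /andP[d0 _] hd] : exists2 d, 0 < d <= 1 & d `^ p <= - m * p / (2 * (H + 1)).
  apply: exists_small_powR => //; rewrite divr_gt0 ?mulr_gt0 ?oppr_gt0//.
  by rewrite ltr_wpDl.
(* A bound for the kernel quotient at the midpoint: [t / u <= 1 - d / (2 * t1)] as soon as
   [u - x >= d] and [u <= t1]. *)
pose rho := (Num.max 0 (1 - d / (2 * t1))) `^ (1 - p).
have p1 : 0 < 1 - p by have /andP[_] := p01; rewrite subr_gt0.
have rho1 : 0 < t1 -> rho < 1.
  move=> t1_gt0; apply: powR_lt1; rewrite ?le_max ?lexx//=.
  by rewrite gt_max ltr01 ltrBlDr ltrDl divr_gt0// mulr_gt0.
(* For [t1 = 0] the convention on division by zero makes [rho = 1], hence the guard; no pair is then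
   away from the diagonal. *)
pose th := Num.max (1 / 2) (if 0 < t1 then rho else 0).
have th1 : th < 1.
  by rewrite /th gt_max; apply/andP; split; [lra|case: ifPn => // /rho1].
suff lb : lbound S (th * m).
  have := lb_le_inf S0 lb; rewrite -/m -subr_ge0 -[X in X - _]mul1r -mulrBl.
  by rewrite leNgt nmulr_llt0// subr_gt0 th1.
move=> _ [x [u [x0 xu ut ->]]].
have u0 := le_trans x0 xu.
have [ud|du] := ltP (u - x) d.
  apply: le_trans (near_diag x u x0 xu ut).
  apply: (@le_trans _ _ (1 / 2 * m)).
    by rewrite ler_wnM2r ?(ltW m0)// /th le_max lexx.
  suff : H * ((u - x) `^ p / p) <= - m / 2 by lra.
  have : (u - x) `^ p <= - m * p / (2 * (H + 1)).
    apply: le_trans hd.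
    by apply: ge0_ler_powR; rewrite ?nnegrE ?subr_ge0 ?(ltW p0) ?(ltW ud) ?(ltW d0).
  move=> h; apply: (@le_trans _ _ (H * (- m * p / (2 * (H + 1)) / p))).
    by rewrite ler_wpM2l// ler_wpM2r// invr_ge0 ltW.
  have -> : H * (- m * p / (2 * (H + 1)) / p) = - m / 2 * (H / (H + 1)).
    by field; rewrite !gt_eqF// ltr_wpDl.
  by rewrite ler_piMr ?divr_ge0 ?oppr_ge0 ?(ltW m0)// ler_pdivrMr ?mul1r ?ltr_wpDl// lerDl.
have xu' : x < u by rewrite -subr_gt0 (lt_le_trans d0).
pose t := (x + u) / 2.
have xt : x < t by rewrite /t; lra.
have tu : t < u by rewrite /t; lra.
have u_gt0 : 0 < u by exact: le_lt_trans x0 xu'.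
have t1_gt0 : 0 < t1 by exact: lt_le_trans ut.
have mA y : 0 <= y <= x -> m <= A y t.
  move=> /andP[y0 yx]; apply: ge_inf => //; exists y, t; split=> //.
    by rewrite (le_trans yx)// ltW.
  by rewrite (le_trans (ltW tu)).
have := memory_comparison x0 xt tu mA.
have hB : 0 <= ((t - x) / (u - x)) `^ (1 - p) * (A x t - m).
  by rewrite mulr_ge0 ?powR_ge0// subr_ge0 mA// x0 lexx.
have hr : (t / u) `^ (1 - p) <= rho.
  have tu0 : 0 <= t / u by rewrite divr_ge0// ltW// (le_lt_trans x0).
  apply: ge0_ler_powR; rewrite ?nnegrE ?(ltW p1) ?le_max ?lexx//.
  apply/orP; right; rewrite ler_pdivrMr//.
  have : d / (2 * t1) * u <= d / 2.
    rewrite invfM mulrA -mulrA ler_piMr// ?divr_ge0 ?(ltW d0)//.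
    by rewrite mulrC ler_pdivrMr// mul1r.
  by move: du; rewrite /t; clear hB Alt0; lra.
have hth : rho <= th by rewrite /th t1_gt0 le_max lexx orbT.
have r1 := le_trans hr hth.
have r0 : 0 <= (t / u) `^ (1 - p) by exact: powR_ge0.
have : th * m <= (t / u) `^ (1 - p) * m by rewrite ler_wnM2r// ltW.
have : (t / u) `^ (1 - p) * w0 <= w0.
  by rewrite ler_piMl ?(ltW w0_gt0)// (le_trans r1)// ltW.
move: hB; move: (_ * (A x t - m)) (A x u) => X Y.
by move: (_ `^ _) => Z; rewrite mulrBr; lra.
Qed.

End Memory.

(** The comparison of kernels with [m = 0], a valid lower bound by [memory_ge0]. *)
Lemma memory_compare0 (R : realType) (p : R) (F w : R -> R) (w0 t1 sg t s : R) :
  0 < p < 1 -> continuous F -> 0 < w0 ->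
  (forall t, 0 <= t <= t1 -> w t = w0 + abel p 0 t t F) ->
  (forall t, 0 <= t <= t1 -> 0 <= w t) ->
  0 <= sg -> sg < t -> t < s -> s <= t1 ->
  w0 * (1 - (t / s) `^ (1 - p)) +
    ((t - sg) / (s - sg)) `^ (1 - p) * (w0 + abel p 0 sg t F) <=
  w0 + abel p 0 sg s F.
Proof.
move=> p01 cF w0p weq wge0 sg0 sgt ts st1.
have tt1 : t <= t1 by rewrite (le_trans (ltW ts)).
have := @memory_comparison R p F w0 p01 cF sg t s 0 sg0 sgt ts.
rewrite !subr0 mulrBr mulr1 [w0 * _]mulrC; apply => x /andP[x0 xsg].
apply: (@memory_ge0 R p F w0 p01 cF w t1) => //.
by rewrite (le_trans xsg)// ltW.
Qed.

(** * Uniform lower bound at the end of an interval *)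

Section LowerBound.
Context {R : realType}.
Implicit Types (p t x M C c : R) (w F : R -> R).

(* [w] is compared at [t1] with its value at a point [t] maximising
   [w t / (t1 - t + eta)]: around such a point [w] is at most doubled on the scale
   [t1 - t + eta], so that the recent past is negligible. *)
Lemma abel_lower_bound p t1 M C : 0 < p < 1 -> 0 < t1 -> 0 <= M -> 0 <= C ->
  exists2 c, 0 < c & forall w F (w0 : R), continuous w -> continuous F -> 0 < w0 ->
    (forall t, 0 <= t <= t1 -> w t = w0 + abel p 0 t t F) ->
    (forall t, 0 <= t <= t1 -> 0 <= w t) ->
    (forall t, 0 <= t <= t1 -> w t <= C * w0) ->
    (forall t, 0 <= t <= t1 -> `|F t| <= M * w t) ->
    c * w0 <= w t1.
Proof.
move=> p01 t10 M0 C0; have /andP[p0 p1] := p01.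
have q0 : 0 < 1 - p by rewrite subr_gt0.
(* On a window of length at most [4 * d] where [w <= 2 * w t], the recent past contributes at most
   [w t / 8]. The bound [3 * d <= t1] keeps the window used below inside [[0, t1]]. *)
have [d4 /andP[d40 d4t] hd4] :
    exists2 d, 0 < d <= t1 / 3 * 4 & d `^ p <= p / (16 * (M + 1)).
  apply: exists_small_powR; rewrite ?divr_gt0 ?mulr_gt0 ?divr_gt0//.
  by rewrite ltr_wpDl.
have [d d4E d0] : exists2 d, d4 = 4 * d & 0 < d.
  by exists (d4 / 4); [field|rewrite divr_gt0].
(* By [powR_onem_le], the kernel quotient [(u / t1)^(1-p)] at [u = t1 - eta / 2] is at most
   [1 - c1 * eta]. *)
have [c1 c1E c10] : exists2 c, c = (1 - p) / (4 * t1) & 0 < c.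
  by exists ((1 - p) / (4 * t1)); rewrite ?divr_gt0// mulr_gt0.
have MC0 : 0 <= M * C by exact: mulr_ge0.
(* For this [eta], when [t] is far from [t1], the past on [[t1 - eta, t1]] costs at most half of the
   gain [w0 * c1 * eta]. *)
have [eta /andP[eta0 etad] heta] :
    exists2 e, 0 < e <= d & e `^ p <= c1 * p * d / (4 * (M * C + 1)).
  apply: exists_small_powR => //; apply: divr_gt0.
    by rewrite !mulr_gt0.
  by rewrite mulr_gt0// ltr_wpDl.
have d3 : 3 * d <= t1 by move: d4t; rewrite d4E; lra.
have te0 : 0 < t1 + eta by rewrite addr_gt0.
(* The first entry serves the case where [t] is far from [t1], the second the case where it is
   within [d] of [t1]. *)
exists (Num.min (eta * c1 / 2) (eta / (4 * (t1 + eta)))).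
  by rewrite lt_min !divr_gt0 ?mulr_gt0.
move=> w F w0 cw cF w0p weq wge0 wC FM.
have den x : x <= t1 -> 0 < t1 - x + eta by move=> xt; rewrite ltr_wpDl ?subr_ge0.
have [||t] := @EVT_max R (fun x => w x / (t1 - x + eta)) 0 t1; first exact: ltW.
  apply: continuous_in_subspaceT => x; rewrite inE/= in_itv/= => /andP[_ xt].
  apply: cvgM; first exact: cw.
  apply: cvgV; first by rewrite gt_eqF// den.
  by apply: cvgD; [apply: cvgB; [exact: cvg_cst|exact: cvg_id]|exact: cvg_cst].
rewrite in_itv/= => tb tmax; have [t0 tt1] := andP tb.
pose del := t1 - t + eta.
have del0 : 0 < del by exact: den.
have wq x : 0 <= x <= t1 -> w x * del <= w t * (t1 - x + eta).
  move=> xb; have := tmax x; rewrite in_itv/= => /(_ xb).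
  by rewrite ler_pdivrMr ?den//; [rewrite mulrAC ler_pdivlMr|case/andP: xb].
have wt0 := wge0 t tb.
have w00 : w 0 = w0.
  by rewrite weq ?lexx ?(ltW t10)// abel_diag_le0// addr0.
(* From here on the predicted value [A] and the recent contribution [I] enter only through these
   four properties. *)
have [A [I [split [recent [cmp A0]]]]] : exists A I : R -> R -> R,
    (forall x s, 0 <= x -> x <= s -> s <= t1 -> w s = A x s + I x s) /\
    (forall x s K, 0 <= x -> x <= s -> s <= t1 ->
      (forall y, x <= y <= s -> w y <= K) -> `|I x s| <= M * K * ((s - x) `^ p / p)) /\
    (forall x u s, 0 <= x -> x < u -> u < s -> s <= t1 ->
      w0 * (1 - (u / s) `^ (1 - p)) + ((u - x) / (s - x)) `^ (1 - p) * A x u <= A x s) /\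
    (forall x s, 0 <= x -> x <= s -> s <= t1 -> 0 <= A x s).
  exists (fun x s => w0 + abel p 0 x s F), (fun x s => abel p x s s F).
  split; first by move=> x s *; exact: (@memory_split R p F w0 p01 cF w t1).
  split; last split.
  - move=> x s K x0 xs st hK.
    have := @abel_bound R p x s s F (M * K) p0 xs (lexx s) cF.
    rewrite subrr powR0 ?gt_eqF// subr0; apply => y /andP[xy ys].
    apply: le_trans (FM y _) _; first by rewrite (le_trans x0 xy) (le_trans ys st).
    by rewrite ler_wpM2l// hK// xy.
  - by move=> x u s *; exact: (@memory_compare0 R p F w w0 t1).
  - by move=> x s *; exact: (@memory_ge0 R p F w0 p01 cF w t1).
(* Near case: maximality against time 0 bounds [w t] below by a multiple of [w0]. On [[t - del, t1]]
   one has [w <= 2 * w t], and the kernel quotient is at least 1/2, so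
   [w t1 >= (7/16 - 1/8) * w t]. *)
have [tclose|tfar] := leP (t1 - d) t.
  have w0t : w0 * (eta / (t1 + eta)) <= w t.
    have := wq 0; rewrite lexx (ltW t10) => /(_ isT).
    rewrite w00 subr0 => h.
    rewrite mulrA ler_pdivrMr//; apply: le_trans h.
    by rewrite ler_wpM2l ?(ltW w0p)// /del lerDr subr_ge0.
  have wt4 : w t / 4 <= w t1.
    have [tt|tne] := eqVneq t t1; first by move: wt0; rewrite tt; lra.
    have ttlt : t < t1 by rewrite lt_neqAle tne.
    pose sg := t - del.
    have del2 : del <= 2 * d by rewrite /del; lra.
    have sg0 : 0 <= sg by rewrite /sg; lra.
    have sgt : sg < t by rewrite /sg; lra.
    have w2 y : sg <= y <= t1 -> w y <= 2 * w t.
      move=> /andP[sy yt]; rewrite -(ler_pM2r del0).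
      apply: le_trans (wq y _) _; first by rewrite (le_trans sg0 sy).
      rewrite [leRHS]mulrAC [leRHS]mulrC ler_wpM2l//.
      by move: sy; rewrite /sg /del; lra.
    have small x s : sg <= x -> x <= s -> s <= t1 -> `|I x s| <= w t / 8.
      move=> sx xs st; apply: le_trans (recent x s (2 * w t) _ _ _ _) _ => //.
      - exact: le_trans sg0 sx.
      - by move=> y /andP[xy ys]; apply: w2; rewrite (le_trans sx xy) (le_trans ys st).
      have : (s - x) `^ p <= p / (16 * (M + 1)).
        apply: le_trans hd4; apply: ge0_ler_powR; rewrite ?nnegrE ?(ltW p0)//.
        - by rewrite subr_ge0.
        - exact: ltW.
        - by move: sx st del2; rewrite d4E /sg /del; lra.
      move=> h; apply: (@le_trans _ _ (M * (2 * w t) * (p / (16 * (M + 1)) / p))).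
        by rewrite ler_wpM2l ?mulr_ge0// ler_wpM2r// invr_ge0 ltW.
      have -> : M * (2 * w t) * (p / (16 * (M + 1)) / p) = w t / 8 * (M / (M + 1)).
        by field; rewrite !gt_eqF// ltr_wpDl.
      by rewrite ler_piMr ?divr_ge0// ler_pdivrMr ?mul1r ?ltr_wpDl// lerDl.
    have e1 := split sg t1 sg0 (ltW (lt_trans sgt ttlt)) (lexx t1).
    have e2 := split sg t sg0 (ltW sgt) tt1.
    have /ler_normlP[s2 _] := small sg t1 (lexx _) (ltW (lt_trans sgt ttlt)) (lexx t1).
    have /ler_normlP[_ s1] := small sg t (lexx _) (ltW sgt) tt1.
    have := cmp sg t t1 sg0 sgt ttlt (lexx t1).
    have hr0 : (t / t1) `^ (1 - p) <= 1.
      apply: powR_le1; first exact: ltW.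
      by rewrite divr_ge0 ?(ltW t10)//= ler_pdivrMr// mul1r.
    have hr1 : 1 / 2 <= ((t - sg) / (t1 - sg)) `^ (1 - p).
      have tsg : t - sg = del by rewrite /sg; ring.
      have t1sg : 0 < t1 - sg by rewrite subr_gt0 (lt_trans sgt).
      have half : 1 / 2 <= (t - sg) / (t1 - sg).
        by rewrite ler_pdivlMr// tsg /sg /del; lra.
      apply: le_trans half _; apply: ger1_powR; last by rewrite gerBl ltW.
      apply/andP; split; first by rewrite divr_gt0// tsg.
      by rewrite ler_pdivrMr// mul1r lerD2r.
    have : 0 <= w0 * (1 - (t / t1) `^ (1 - p)) by rewrite mulr_ge0 ?subr_ge0// ltW.
    move: (w0 * (1 - _)) => X X0.
    have : 1 / 2 * (w t - w t / 8) <=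
        ((t - sg) / (t1 - sg)) `^ (1 - p) * A sg t.
      apply: ler_pM => //; first by lra.
      by move: e2 s1; lra.
    move: (_ * A sg t) => Y hY; rewrite e1; move: s2; lra.
  apply: le_trans wt4; rewrite -ler_pdivlMr//.
  apply: le_trans (_ : eta / (4 * (t1 + eta)) <= _); first by rewrite ge_min lexx orbT.
  by rewrite ler_pdivlMr// invfM; move: w0t; lra.
have deld : d <= del by move: tfar; rewrite /del; lra.
(* Far case: [del >= d], so maximality makes [w] at most of order [eta * w0] on [[t1 - eta, t1]].
   The initial value alone yields a gain of order [eta * w0], while the recent past is smaller by a
   factor of order [eta^p]. *)
pose sg := t1 - eta; pose u := t1 - eta / 2.
have sg0 : 0 <= sg by rewrite /sg; lra.
have sgu : sg < u by rewrite /sg /u; lra.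
have ut : u < t1 by rewrite /u; lra.
have wsm y : sg <= y <= t1 -> w y <= C * w0 * (2 * eta) / d.
  move=> /andP[sy yt]; rewrite ler_pdivlMr//.
  have yb : 0 <= y <= t1 by rewrite (le_trans sg0 sy).
  apply: (@le_trans _ _ (w y * del)); first by rewrite ler_wpM2l// wge0.
  apply: le_trans (wq y yb) _; apply: ler_pM => //.
  - by rewrite ltW// den.
  - exact: wC.
  - by move: sy; rewrite /sg; lra.
have := recent sg t1 _ sg0 (ltW (lt_trans sgu ut)) (lexx t1) wsm.
have -> : t1 - sg = eta by rewrite /sg; ring.
have CW : 0 <= C * w0 by rewrite mulr_ge0// ltW.
have : M * (C * w0 * (2 * eta) / d) * (eta `^ p / p) <= w0 * (eta * c1 / 2).
  apply: (@le_trans _ _ (M * (C * w0 * (2 * eta) / d) *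
      (c1 * p * d / (4 * (M * C + 1)) / p))).
    rewrite ler_wpM2l//; last by rewrite ler_wpM2r// invr_ge0 ltW.
    by rewrite mulr_ge0// divr_ge0 ?(ltW d0)// mulr_ge0// mulr_ge0// ltW.
  have -> : M * (C * w0 * (2 * eta) / d) * (c1 * p * d / (4 * (M * C + 1)) / p) =
      w0 * (eta * c1 / 2) * (M * C / (M * C + 1)).
    by field; rewrite !gt_eqF// ltr_wpDl.
  rewrite ler_piMr ?mulr_ge0 ?divr_ge0 ?(ltW w0p) ?mulr_ge0 ?(ltW c10) ?(ltW eta0)//.
  by rewrite ler_pdivrMr ?mul1r ?ltr_wpDl// lerDl.
move=> h /le_trans/(_ h)/ler_normlP[s1 _].
have := cmp sg u t1 sg0 sgu ut (lexx t1).
have hr0 : (u / t1) `^ (1 - p) <= 1 - c1 * eta.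
  have -> : u / t1 = 1 - eta / (2 * t1) by rewrite /u; field; rewrite gt_eqF.
  have := @powR_onem_le R (1 - p) (eta / (2 * t1)).
  have -> : (1 - p) * (eta / (2 * t1)) / 2 = c1 * eta by rewrite c1E; field; rewrite gt_eqF.
  apply; first by rewrite q0 gerBl ltW.
  rewrite divr_ge0 ?mulr_ge0 ?(ltW eta0) ?(ltW t10)//= ltr_pdivrMr ?mulr_gt0// mul1r.
  by lra.
have hB : 0 <= ((u - sg) / (t1 - sg)) `^ (1 - p) * A sg u.
  by rewrite mulr_ge0 ?powR_ge0// A0// ltW.
have hw : w0 * (c1 * eta) <= w0 * (1 - (u / t1) `^ (1 - p)).
  by rewrite ler_wpM2l ?(ltW w0p)//; move: hr0; lra.
have e1 := split sg t1 sg0 (ltW (lt_trans sgu ut)) (lexx t1).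
move: hB; move: (_ * A sg u) => Y Y0.
move: hw; move: (w0 * (1 - _)) => X hX hZ.
apply: (@le_trans _ _ (eta * c1 / 2 * w0)).
  by rewrite ler_wpM2r ?(ltW w0p)// ge_min lexx.
by rewrite e1; move: s1 hZ hX Y0; lra.
Qed.

End LowerBound.

(** * The flow of the Volterra equation *)

(** The zeros in [[0, b]] form a nonempty compact set; a nonpositive value before the least of them
    would produce an earlier one. *)
Lemma first_zero (R : realType) (w : R -> R) (b : R) :
  continuous w -> 0 < w 0 -> 0 <= b -> w b <= 0 ->
  exists t1, [/\ 0 < t1, t1 <= b, w t1 = 0 & forall t, 0 <= t < t1 -> 0 < w t].
Proof.
move=> cw w0 b0 wb.
have ivt t : 0 <= t -> w t <= 0 -> exists2 z, 0 <= z <= t & w z = 0.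
  move=> t0 wt; have [||z] := @IVT R w 0 t 0 t0.
  - exact: continuous_subspaceT.
  - by rewrite ge_min wt orbT le_max (ltW w0).
  - by rewrite in_itv/= => zt wz; exists z.
have [z /andP[z0 zb] wz] := ivt b b0 wb.
pose Z := `[0, b]%classic `&` w @^-1` [set 0].
have cZ : compact Z.
  apply: compact_closedI; first exact: segment_compact.
  apply: closed_comp; last exact: closed_eq.
  by move=> x _; exact: cw.
have Z0 : Z !=set0 by exists z; split => //=; rewrite in_itv/= z0.
have [|t1] := @compact_EVT_min R R id Z Z0 cZ.
  by apply: continuous_subspaceT => x; exact: cvg_id.
rewrite inE /Z/= in_itv/= => -[/andP[t10 t1b] wt1] tmin.
exists t1; split=> //.
  by rewrite lt_neqAle t10 andbT; apply/eqP => t1E; move: w0; rewrite t1E wt1 -t1E ltxx.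
move=> t /andP[t0 tt1]; rewrite ltNge; apply/negP => wt.
have [y /andP[y0 yt] wy] := ivt t t0 wt.
have := tmin y; rewrite inE /Z/= in_itv/= y0 wy (le_trans yt) ?(le_trans (ltW tt1))//.
by move=> /(_ (conj isT erefl)); rewrite leNgt (le_lt_trans yt tt1).
Qed.

Section VolterraFlow.
Context {R : realType}.
Variables (p : R) (g : R -> R -> R) (L : R -> R).
Hypothesis p01 : 0 < p < 1.
Hypothesis cg : continuous (fun z : R * R => g z.1 z.2).
Hypothesis cL : continuous L.
Hypothesis lip : forall t x y, `|g t x - g t y| <= L t * `|x - y|.
Implicit Types (b t s M lam K : R).

Let p0 : 0 < p. Proof. by have /andP[] := p01. Qed.

(** The lower bound is applied to the difference, with [C = 2 * exp(lam * t1)] from Lipschitz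
    dependence. The order of the solutions is assumed here; [volterra_lt] then derives it from this
    very estimate. *)
Lemma volterra_separation t1 : 0 < t1 ->
  exists2 c, 0 < c & forall (x0 y0 : R) (x y : R -> R), x0 < y0 ->
    volterra_sol p g t1 x0 x -> volterra_sol p g t1 y0 y ->
    (forall t, 0 <= t <= t1 -> 0 <= y t - x t) -> c * (y0 - x0) <= y t1 - x t1.
Proof.
move=> t10; have [M M0 hM] := lipschitz_bound cL t1.
have [lam lam0 dep] := volterra_dependence p01 cg cL lip (ltW t10).
have C0 : 0 <= 2 * expR (lam * t1) by rewrite mulr_ge0 ?expR_ge0.
have [c c0 hc] := abel_lower_bound p01 t10 M0 C0.
exists c => // x0 y0 x y xy solx soly wge0.
have [cx ex] := solx; have [cy ey] := soly.
have cgx := continuous_nemytskii cg cx; have cgy := continuous_nemytskii cg cy.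
apply: (hc (fun t => y t - x t) (fun t => g t (y t) - g t (x t))) => //.
- by move=> t; apply: cvgB; [exact: cy|exact: cx].
- by move=> t; apply: cvgB; [exact: cgy|exact: cgx].
- by rewrite subr_gt0.
- move=> t tb; rewrite abelB// ex// ey//.
  by rewrite opprD addrACA.
- move=> t tb; apply: le_trans (ler_norm _) _.
  apply: le_trans (dep y0 x0 y x soly solx t tb) _.
  rewrite ger0_norm ?subr_ge0 ?(ltW xy)// mulrAC ler_wpM2r ?subr_ge0 ?(ltW xy)//.
  rewrite ler_wpM2l// ler_expR ler_wpM2l ?(ltW lam0)//.
  by have /andP[] := tb.
- move=> t tb; apply: le_trans (lip _ _ _) _.
  by rewrite [`|y t - x t|]ger0_norm ?wge0// ler_wpM2r ?wge0// hM.
Qed.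

(** At a first contact time the separation estimate would make the difference positive. *)
Lemma volterra_lt b (x0 y0 : R) (x y : R -> R) : x0 < y0 -> 0 <= b ->
  volterra_sol p g b x0 x -> volterra_sol p g b y0 y ->
  forall t, 0 <= t <= b -> x t < y t.
Proof.
move=> xy b0 [cx ex] [cy ey] t /andP[t0 tb]; rewrite ltNge; apply/negP => yx.
pose w s := y s - x s.
have cw : continuous w by move=> s; apply: cvgB; [exact: cy|exact: cx].
have w0 : 0 < w 0.
  by rewrite /w ex ?lexx// ey ?lexx// !abel_diag_le0// !addr0 subr_gt0.
have wt : w t <= 0 by rewrite /w subr_le0.
have [t1 [t10 t1t wt1 wpos]] := first_zero cw w0 t0 wt.
have [c c0 hc] := volterra_separation t10.
have sub z : 0 <= z <= t1 -> 0 <= z <= b.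
  by move=> /andP[-> zt]/=; rewrite (le_trans zt)// (le_trans t1t).
suff : c * (y0 - x0) <= w t1 by rewrite wt1 leNgt mulr_gt0// subr_gt0.
apply: hc => //.
- by split=> // z /sub; exact: ex.
- by split=> // z /sub; exact: ey.
- move=> z /andP[z0]; rewrite le_eqVlt => /predU1P[->|zt1]; first by rewrite -/(w t1) wt1.
  by rewrite ltW// wpos// z0.
Qed.

Theorem volterra_flow : exists Phi Psi : R -> R -> R,
  [/\ forall x0, continuous (Phi ^~ x0) /\
        forall t, Phi t x0 = x0 + abel p 0 t t (fun s => g s (Phi s x0)),
      forall t, cancel (Phi t) (Psi t) /\ cancel (Psi t) (Phi t),
      continuous (fun z : R * R => Phi z.1 z.2) &
      continuous (fun z : R * R => Psi z.1 z.2)].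
Proof.
have [sol hsol] := choice (volterra_exists p01 cg cL lip).
pose Phi t x0 := sol x0 t.
have solV b x0 : volterra_sol p g b x0 (sol x0).
  by have [c e] := hsol x0; split => // t _; exact: e.
have PhiN t x0 : t <= 0 -> Phi t x0 = x0.
  by move=> t0; rewrite /Phi; have [_ ->] := hsol x0; rewrite abel_diag_le0// addr0.
have Phi_lt t x0 y0 : x0 < y0 -> Phi t x0 < Phi t y0.
  move=> xy; have [t0|t0] := leP t 0; first by rewrite !PhiN.
  by apply: (volterra_lt xy (ltW t0) (solV t x0) (solV t y0)); rewrite (ltW t0) lexx.
have Phi_lip b : exists2 K, 0 < K & forall t x0 y0, t <= b ->
    `|Phi t x0 - Phi t y0| <= K * `|x0 - y0|.
  have b0 : 0 <= Num.max 0 b by rewrite le_max lexx.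
  have [lam lam0 dep] := volterra_dependence p01 cg cL lip b0.
  exists (2 * expR (lam * Num.max 0 b)); first by rewrite mulr_gt0 ?expR_gt0.
  move=> t x0 y0 tb; have [t0|t0] := leP t 0.
    rewrite !PhiN// ler_peMl//.
    have : 1 <= expR (lam * Num.max 0 b) by rewrite -expR0 ler_expR mulr_ge0// ltW.
    by lra.
  have tb' : 0 <= t <= Num.max 0 b by rewrite (ltW t0) le_max tb orbT.
  apply: le_trans (dep x0 y0 _ _ (solV _ x0) (solV _ y0) t tb') _.
  rewrite mulrAC ler_wpM2r// ler_wpM2l// ler_expR ler_wpM2l ?(ltW lam0)//.
  by have /andP[] := tb'.
have Phi_ct x0 : continuous (Phi ^~ x0) by have [c _] := hsol x0.
have Phi_cont : continuous (fun z : R * R => Phi z.1 z.2).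
  move=> [t x0]; apply/cvgrPdist_lt => /= e e0.
  (* Joint continuity combines continuity in time at fixed [x0] with a Lipschitz constant in [x0]
     common to all times up to [t + 1]. *)
  have [K K0 hK] := Phi_lip (t + 1).
  have n1 : \forall z \near (t, x0), `|Phi t x0 - Phi z.1 x0| < e / 2.
    have c1 : (fun z : R * R => Phi z.1 x0) @ (t, x0) --> Phi t x0.
      apply: (@cvg_comp _ _ _ fst (Phi ^~ x0) _ (nbhs t)); first exact: cvg_fst.
      exact: Phi_ct.
    by move/cvgrPdist_lt : c1; apply; rewrite divr_gt0.
  have n2 : \forall z \near (t, x0), `|x0 - z.2| < e / 2 / K.
    have c2 : (fun z : R * R => z.2) @ (t, x0) --> x0 by exact: cvg_snd.
    by move/cvgrPdist_lt : c2; apply; rewrite !divr_gt0.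
  have n3 : \forall z \near (t, x0), `|t - z.1| < 1.
    have c3 : (fun z : R * R => z.1) @ (t, x0) --> t by exact: cvg_fst.
    by move/cvgrPdist_lt : c3; apply.
  near=> z.
  have h1 : `|Phi t x0 - Phi z.1 x0| < e / 2 by near: z.
  have h2 : `|x0 - z.2| < e / 2 / K by near: z.
  have h3 : `|t - z.1| < 1 by near: z.
  have zt : z.1 <= t + 1.
    by move: h3; rewrite distrC ltr_distl => /andP[_ /ltW].
  have h4 := hK z.1 x0 z.2 zt.
  rewrite -(subrKA (Phi z.1 x0)); apply: le_lt_trans (ler_normD _ _) _.
  rewrite (splitr e) ltrD//; apply: le_lt_trans h4 _.
  by rewrite mulrC -ltr_pdivlMr.
have Phi_surj t v : exists x0, Phi t x0 = v.
  have [t0|t0] := leP t 0; first by exists v; rewrite PhiN.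
  have [c c0 hc] := volterra_separation t0.
  have sep x0 y0 : x0 < y0 -> c * (y0 - x0) <= Phi t y0 - Phi t x0.
    move=> xy; apply: hc => // s sb; rewrite subr_ge0 ltW//.
    by apply: (volterra_lt xy (ltW t0) (solV t x0) (solV t y0)).
  (* By [sep], [Phi t] changes by at least [c * n] on either side of 0, so [v] lies between
     [Phi t (- n)] and [Phi t n]; the summand 1 makes [n] positive. *)
  pose n := `|v - Phi t 0| / c + 1.
  have n0 : 0 < n by rewrite ltr_wpDl// divr_ge0// ltW.
  have cn : `|v - Phi t 0| <= c * n.
    by rewrite /n mulrDr mulrCA mulfV ?gt_eqF// !mulr1 lerDl ltW.
  have up := sep 0 n n0; have := sep (- n) 0; rewrite oppr_lt0 => /(_ n0) dn.
  rewrite subr0 in up; rewrite sub0r opprK in dn.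
  have nn : - n <= n by rewrite ge0_cp ?(ltW n0).
  have [||x0 _ hx0] := @IVT R (Phi t) (- n) n v nn.
  - apply: continuous_subspaceT.
    by apply: (continuous_comp2 Phi_cont) => x0; [exact: cvg_cst|exact: cvg_id].
  - move: cn; rewrite ler_norml => /andP[cn1 cn2].
    rewrite ge_min le_max; apply/andP; split; apply/orP; [left|right].
      by move: dn cn1; move: (c * n) => X; lra.
    by move: up cn2; move: (c * n) => X; lra.
  - by exists x0.
have [Psi hPsi] := choice (fun z : R * R => Phi_surj z.1 z.2).
have PsiK t : cancel (fun v => Psi (t, v)) (Phi t) by move=> v; exact: (hPsi (t, v)).
have Phi_inj t : injective (Phi t).
  move=> x y /eqP; apply: contraTeq; rewrite neq_lt => /orP[] xy.
    by rewrite lt_eqF// Phi_lt.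
  by rewrite gt_eqF// Phi_lt.
exists Phi, (fun t v => Psi (t, v)); split => //.
- by move=> t; split => // x; apply: (Phi_inj t); rewrite PsiK.
- move=> [t v]; apply/cvgrPdist_lt => /= e e0.
  set x0 := Psi (t, v).
  have Phix : Phi t x0 = v by exact: PsiK.
  have mono s a d : (Phi s a < Phi s d) -> a < d.
    move=> h; rewrite ltNge le_eqVlt; apply/negP => /predU1P[E|/(Phi_lt s)].
      by move: h; rewrite E ltxx.
    by rewrite ltNge (ltW h).
  have cPz a : (fun z : R * R => z.2 - Phi z.1 a) @ (t, v) --> v - Phi t a.
    apply: cvgB; first exact: cvg_snd.
    apply: (@cvg_comp _ _ _ fst (Phi ^~ a) _ (nbhs t)); first exact: cvg_fst.
    exact: Phi_ct.
  (* The strict inequalities [Phi t (x0 - e) < v < Phi t (x0 + e)] persist for nearby times and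
     values; monotonicity at the nearby time turns them into a bound of [e] on the change of
     [Psi]. *)
  have n1 : \forall z \near (t, v), 0 < z.2 - Phi z.1 (x0 - e).
    apply: (cvgr_gt _ (cPz (x0 - e))); rewrite subr_gt0 -Phix; apply: Phi_lt.
    by rewrite ltrBlDr ltrDl.
  have n2 : \forall z \near (t, v), z.2 - Phi z.1 (x0 + e) < 0.
    apply: (cvgr_lt _ (cPz (x0 + e))); rewrite subr_lt0 -Phix; apply: Phi_lt.
    by rewrite ltrDl.
  near=> z.
  rewrite distrC ltr_distl; apply/andP; split; apply: (mono z.1); rewrite PsiK.
    by rewrite -subr_gt0; near: z.
  by rewrite -subr_lt0; near: z.
Unshelve. all: by end_near. Qed.

End VolterraFlow.

(** * The fractional equation on an interval *)

Lemma within_continuous_comp (X Y Z : topologicalType) (A : set Y)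
    (f : Y -> Z) (h : X -> Y) :
  {within A, continuous f} -> continuous h -> (forall x, A (h x)) ->
  continuous (f \o h).
Proof.
move=> /subspace_continuousP cf ch hA x.
apply: (@cvg_comp _ _ _ h f _ (within A (nbhs (h x)))); last exact: cf.
move=> P AP; have hP : \forall y \near x, A (h y) -> P (h y) := ch x _ AP.
change (\forall y \near x, P (h y)).
by apply: filterS hP => y; apply; exact: hA.
Qed.

(** The retraction [cl] of the line onto the interval: composing with it extends [f], [L] and the
    solutions continuously to all times. *)
Lemma Jint_clamp (R : realType) (T : \bar R) : (0 < T)%E ->
  exists cl : R -> R, [/\ continuous cl, forall t, Jint T (cl t) &
    forall t, Jint T t -> cl t = t].
Proof.
have cmax (h : R -> R) : continuous h -> continuous (fun t => Num.max 0 (h t)).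
  by move=> ch t; apply: continuous_max; [exact: cvg_cst|exact: ch].
case: T => [r||] //; rewrite /Jint /=.
  rewrite lte_fin => r0; exists (fun t => Num.max 0 (Num.min t r)); split.
  - by apply: cmax => t; apply: continuous_min; [exact: cvg_id|exact: cvg_cst].
  - by move=> t; rewrite lee_fin le_max lexx ge_max (ltW r0) ge_min lexx orbT.
  - by move=> t [t0]; rewrite lee_fin => tr; rewrite min_l// max_r.
move=> _; exists (fun t => Num.max 0 t); split.
- by apply: cmax => t; exact: cvg_id.
- by move=> t; rewrite leey le_max lexx.
- by move=> t [t0 _]; rewrite max_r.
Qed.

Lemma linear_cancel (R : realType) (f h : R -> R) : cancel f h -> cancel h f ->
  (forall c x y, f (c * x + y) = c * f x + f y) ->
  forall c x y, h (c * x + y) = c * h x + h y.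
Proof. by move=> fh hf lin c x y; apply: (can_inj fh); rewrite lin !hf. Qed.

Section FractionalEquation.
Context {R : realType}.
Variables (alpha : R) (T : \bar R) (f : R -> R -> R) (cl : R -> R).
Hypothesis alpha01 : 0 < alpha < 1.
Hypothesis cf : {within [set p : R * R | Jint T p.1],
  continuous (fun p : R * R => f p.1 p.2)}.
Hypothesis ccl : continuous cl.
Hypothesis Jcl : forall t, Jint T (cl t).
Hypothesis clK : forall t, Jint T t -> cl t = t.

Let g t x := (Gamma alpha)^-1 * f (cl t) x.

Lemma continuous_clamped : continuous (fun z : R * R => f (cl z.1) z.2).
Proof.
apply: (@within_continuous_comp _ _ _ _ _ (fun z : R * R => (cl z.1, z.2)) cf) => //.
  move=> z; have c1 : (fun z : R * R => cl z.1) @ z --> cl z.1.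
    by apply: (@cvg_comp _ _ _ fst cl _ (nbhs z.1)); [exact: cvg_fst|exact: ccl].
  have c2 : (fun z : R * R => z.2) @ z --> z.2 by exact: cvg_snd.
  exact: (cvg_pair c1 c2).
by move=> z /=; exact: Jcl.
Qed.

Lemma Jint_le t s : Jint T t -> 0 <= s <= t -> Jint T s.
Proof.
by move=> [t0 tT] /andP[s0 st]; split=> //; apply: le_trans tT; rewrite lee_fin.
Qed.

Lemma abel_clamped (x : R -> R) t : continuous (x \o cl) -> Jint T t ->
  abel alpha 0 t t (fun s => g s (x (cl s))) =
  (Gamma alpha)^-1 * \int[@lebesgue_measure R]_(tau in `[0, t])
    ((t - tau) `^ (alpha - 1) * f tau (x tau)).
Proof.
move=> cx Jt; have /andP[a0 _] := alpha01.
rewrite /g abelZ//; last first.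
  exact: (@continuous_nemytskii R (fun s => f (cl s)) continuous_clamped (x \o cl) cx).
congr (_ * _); apply: eq_Rintegral => s; rewrite inE/= in_itv/= => sb.
by rewrite clK//; exact: Jint_le sb.
Qed.

Lemma frac_solution_volterra (x : R -> R) b :
  is_frac_solution alpha f (Jint T) x -> Jint T b ->
  volterra_sol alpha g b (x 0) (x \o cl).
Proof.
move=> [cx ex] Jb.
have cxc : continuous (x \o cl) by exact: within_continuous_comp cx ccl Jcl.
split=> // t tb; have Jt := Jint_le Jb tb.
by rewrite abel_clamped// -ex//= clK.
Qed.

Lemma volterra_frac_solution (x : R -> R) x0 : continuous x ->
  (forall t, x t = x0 + abel alpha 0 t t (fun s => g s (x s))) ->
  is_frac_solution alpha f (Jint T) x /\ x 0 = x0.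
Proof.
move=> cx ex; have x00 : x 0 = x0 by rewrite ex abel_diag_le0// addr0.
split=> //; split; first exact: continuous_subspaceT.
move=> t Jt; rewrite x00 -abel_clamped//.
  rewrite ex; congr (_ + _); apply: abel_eq => s sb.
  by rewrite clK//; exact: Jint_le sb.
by move=> s; apply: continuous_comp; [exact: ccl|exact: cx].
Qed.

End FractionalEquation.

(** * Bijectivity, flow property and linearity of the evolution maps *)

Unset Implicit Arguments.

Theorem mainTheorem6 (R : realType) (alpha : R) (T : \bar R)
  (f : R -> R -> R) (L : R -> R) :
  0 < alpha < 1 ->
  (0 < T)%E ->
  {within [set p : R * R | Jint T p.1], continuous (fun p : R * R => f p.1 p.2)} ->
  {within Jint T, continuous L} ->
  (forall t, Jint T t -> 0 <= L t) ->
  (forall t x y, Jint T t -> `|f t x - f t y| <= L t * `|x - y|) ->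
  (* (i) *)
  (forall t, Jint T t -> bijective (evol0 alpha f (Jint T) t)) /\
  (* (ii)-(iv), with Phi_{s,t} := Phi_{0,t} \o Phi_{0,s}^{-1} *)
  exists inv0 : R -> R -> R,
    (forall s, Jint T s ->
       cancel (evol0 alpha f (Jint T) s) (inv0 s) /\
       cancel (inv0 s) (evol0 alpha f (Jint T) s)) /\
    let Phi := fun s t : R => evol0 alpha f (Jint T) t \o inv0 s in
    [/\ (forall s t, Jint T s -> Jint T t -> bijective (Phi s t)),
        (forall u s t, Jint T u -> Jint T s -> Jint T t ->
            Phi s t \o Phi u s = Phi u t),
        two_param_flow (Jint T) Phi &
        ((exists a : R -> R, forall t x, Jint T t -> f t x = a t * x) ->
         forall s t, Jint T s -> Jint T t ->
           forall c x y, Phi s t (c * x + y) = c * Phi s t x + Phi s t y)].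
Proof.
move=> alpha01 T0 cf cL L0 lip.
have [cl [ccl Jcl clK]] := Jint_clamp T0.
pose c := (Gamma alpha)^-1.
pose g t x := c * f (cl t) x.
have cg : continuous (fun z : R * R => g z.1 z.2).
  by move=> z; apply: cvgMr; exact: (continuous_clamped cf ccl Jcl).
have cL' : continuous (fun t => `|c| * L (cl t)).
  by move=> t; apply: cvgMr; exact: (within_continuous_comp cL ccl Jcl).
have lip' t x y : `|g t x - g t y| <= `|c| * L (cl t) * `|x - y|.
  by rewrite /g -mulrBr normrM -mulrA ler_wpM2l// lip.
have [Phi [Psi [solPhi PhiK cPhi cPsi]]] := volterra_flow alpha01 cg cL' lip'.
(* [evol0] selects some solution: [Phi] shows that one exists, and uniqueness on [[0, t]] identifies
   the selected value with [Phi t x0]. *)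
have evolE t x0 : Jint T t -> evol0 alpha f (Jint T) t x0 = Phi t x0.
  move=> Jt; have [cPx ePx] := solPhi x0.
  have fr := volterra_frac_solution alpha01 cf ccl Jcl clK cPx ePx.
  pose S := [set x : R -> R | is_frac_solution alpha f (Jint T) x /\ x 0 = x0].
  have [] : S (get S) by apply: getPex; exists (Phi ^~ x0).
  rewrite /evol0 -/S => sol get0.
  have := frac_solution_volterra alpha01 cf ccl Jcl clK sol Jt.
  rewrite get0 => solV.
  have solP : volterra_sol alpha g t x0 (Phi ^~ x0) by split => // s _; exact: ePx.
  have [t0 _] := Jt.
  have := volterra_unique alpha01 cg cL' lip' solV solP (t := t).
  by rewrite t0 lexx /= clK// => ->.
have evolF t : Jint T t -> evol0 alpha f (Jint T) t = Phi t.
  by move=> Jt; apply/funext => x; exact: evolE.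
have bijPP s t : bijective (Phi t \o Psi s).
  by exists (Phi s \o Psi t) => x /=; rewrite ?(PhiK t).1 ?(PhiK s).2// (PhiK s).1 (PhiK t).2.
have compPP u s t : (Phi t \o Psi s) \o (Phi s \o Psi u) = Phi t \o Psi u.
  by apply/funext => x /=; rewrite (PhiK s).1.
have cont2 (h k : R -> R -> R) : continuous (fun z : R * R => h z.1 z.2) ->
    continuous (fun z : R * R => k z.1 z.2) ->
    continuous (fun q : (R * R) * R => h q.1.2 (k q.1.1 q.2)).
  move=> ch ck; apply: (continuous_comp2 ch) => [q|].
    apply: (@cvg_comp _ _ _ fst snd _ (nbhs q.1)); first exact: cvg_fst.
    exact: cvg_snd.
  apply: (continuous_comp2 ck) => q; last exact: cvg_snd.
  by apply: (@cvg_comp _ _ _ fst fst _ (nbhs q.1)); exact: cvg_fst.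
have contPP s t : continuous (Phi t \o Psi s).
  apply: (continuous_comp2 cPhi); first by move=> x; exact: cvg_cst.
  by apply: (continuous_comp2 cPsi) => x; [exact: cvg_cst|exact: cvg_id].
split.
  move=> t Jt; rewrite evolF//.
  by exists (Psi t); [exact: (PhiK t).1|exact: (PhiK t).2].
exists Psi; split; first by move=> s Js; rewrite evolF.
split.
- by move=> s t Js Jt; rewrite evolF.
- by move=> u s t Ju Js Jt; rewrite !evolF.
- split.
  (* The identification of [evol0] holds only at times in the interval, so continuity is carried
     over from the globally continuous map by equality on the subspace. *)
  + apply: (@subspace_eq_continuous _ _ _ (fun q : (R * R) * R => Phi q.1.2 (Psi q.1.1 q.2))).
      by move=> q; rewrite inE/= => -[_ Jq]; rewrite /from_subspace/= evolE.
    exact: continuous_subspaceT (cont2 _ _ cPhi cPsi).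
  + move=> s t Js Jt; rewrite evolF//; split => //.
    exists (Phi s \o Psi t); split => // x /=.
      by rewrite (PhiK t).1 (PhiK s).2.
    by rewrite (PhiK s).1 (PhiK t).2.
  + by move=> u s t Ju Js Jt; rewrite !evolF.
- move=> [a fa] s t Js Jt k x y; rewrite evolF//=.
  (* The combination of two solutions solves the equation with the combined initial value, since [f]
     is linear at the clamped times; uniqueness concludes. *)
  have lin r k' x0 y0 : Jint T r -> Phi r (k' * x0 + y0) = k' * Phi r x0 + Phi r y0.
    move=> Jr; have [r0 _] := Jr; have /andP[a0 _] := alpha01.
    have [cx ex] := solPhi x0; have [cy ey] := solPhi y0.
    have cgx := continuous_nemytskii cg cx; have cgy := continuous_nemytskii cg cy.
    apply: (volterra_unique alpha01 cg cL' lip' (b := r) (x0 := k' * x0 + y0)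
      (x := Phi ^~ (k' * x0 + y0)) (y := fun s => k' * Phi s x0 + Phi s y0)).
    + by have [cz ez] := solPhi (k' * x0 + y0); split => // u _; exact: ez.
    + split.
        by move=> u; apply: cvgD; [apply: cvgMr; exact: cx|exact: cy].
      move=> u ur; rewrite {1}ex {1}ey mulrDr addrACA; congr (_ + _).
      rewrite -abelZ// -abelD//; last by move=> v; apply: cvgMr; exact: cgx.
      apply: abel_eq => v vu; rewrite /g !fa//.
      by ring.
    + by rewrite r0 lexx.
  have linPsi := linear_cancel (PhiK s).1 (PhiK s).2 (fun k x y => lin s k x y Js).
  by rewrite linPsi lin.
Qed.
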